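(* Let $L\ge 1$ and let $g_L$ be a graph over $[L]$. For every $n\ge 1$ let $g'_n$ be a graph over $[n]$, and assume that $g'_n\to w$ in the graphon sense, for some graphon $w$. Let $a\in\mathcal{A}$ be a self-adjoint random variable with mean $\lambda$ and variance $\sigma^2$. Let $(\mathcal{A}_l)_{l\in[L]}$ be $g_L$-independent subalgebras of $\mathcal{A}$ and, for each $n$ and each $l\in[L]$, let $(a_k^{(l)})_{k\in[n]}\subset\mathcal{A}_l$ be $g'_n$-independent and identically distributed (self-adjoint) random variables with common law that of $a$. Let $$S_n=\frac{1}{\sqrt n}\sum_{k\in[n]}\Big(\prod_{l=1}^L a_k^{(l)}-\lambda^L\Big).$$ Then, as $n\to\infty$, $S_n$ converges in $*$-distribution to $$\sum_{J\in\mathcal{P}^*(L)}\sigma^{|J|}\lambda^{|J^c|}\,s_J,$$ where $(s_I)_{I\in\mathcal{P}^*(L)}$ is a family of noncommutative random variables whose joint law depends only on $g_L$ and $w$ and is given as follows: for every $p\ge 1$, $J=(J_1,\dots,J_p)\in\mathcal{P}^*(L)^p$ and $\alpha\in\{1,*\}^p$, $$\tau(s_{J_1}^{\alpha_1}\cdots s_{J_p}^{\alpha_p})=\sum_{\pi\in P_2^{J,\alpha}(p)}\int_{[0,1]^{V(f_\pi)}}\prod_{(u,v)\in E(f_\pi)}w^*_{J_uJ_v}(x_u,x_v)\,\mathrm{d}x .$$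
   Context: Notation: $[n]=\{1,\dots,n\}$; all graphs are simple and loopless. $(\mathcal{A},\tau)$ is a noncommutative probability space (a unital $*$-algebra with a state $\tau$). The mean of $a$ is $\tau(a)$, its variance is $\tau(a^2)-\tau(a)^2$. For $t\in\{1,*\}$, $x^1=x$ and $x^*$ is the adjoint. $\mathcal{P}^*(L)$ is the collection of nonempty subsets of $[L]$; $J^c=[L]\setminus J$. Products $\prod_{l}a_k^{(l)}$ are taken in increasing order of $l$. $g$-independence: for a loopless graph $g$ with finite vertex set $V$ and edge set $E$, subalgebras $(\mathcal{A}_v)_{v\in V}$ of $\mathcal{A}$ are $g$-independent if (1) for every $(i,j)\in E$, $\mathcal{A}_i,\mathcal{A}_j$ are classically independent (in particular they commute); (2) for every $k\ge1$ and $i\in V^k$ such that for all $j_1<j_2$ with $i_{j_1}=i_{j_2}$ there exists $j_1<j_3<j_2$ with $(i_{j_1},i_{j_3})\notin E$, one has $\tau(a_1\cdots a_k)=0$ for all centered $a_j\in\mathcal{A}_{i_j}$, $j\in[k]$. Random variables are $g$-independent if the subalgebras they generate are. Graphons: a graphon is a measurable symmetric $w:[0,1]^2\to[0,1]$. For finite graphs $f,g$, $\rho(f,w)=\int_{[0,1]^{V(f)}}\prod_{(u,v)\in E(f)}w(x_u,x_v)\,\mathrm{d}x$ and $\rho(f,g)=|V(g)|^{-|V(f)|}\sum_{\phi:V(f)\to V(g)}\prod_{(u,v)\in E(f)}\mathbf 1_{(\phi(u),\phi(v))\in E(g)}$. Graphs $g'_n$ on $n$ nodes converge to $w$ in the graphon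 sense if $\rho(f,g'_n)\to\rho(f,w)$ for every simple finite graph $f$. In products over edges each undirected edge is counted once. Convergence in $*$-distribution of $b_n$ to $z$ means $\tau(b_n^{t_1}\cdots b_n^{t_k})\to\tau(z^{t_1}\cdots z^{t_k})$ for all $k\ge1$, $t\in\{1,*\}^k$ (the limit may live in another noncommutative probability space, whose state is also denoted $\tau$). Partitions: $P_2(p)$ is the set of pair partitions of $[p]$. For $\pi\in P_2(p)$ the intersection graph $f_\pi$ has the blocks of $\pi$ as vertices, with an edge between two blocks if they cross. For $J\in\mathcal{P}^*(L)^p$, $P_2^J(p)=\{\pi\in P_2(p):J_r=J_s\ \forall\{r,s\}\in\pi\}$, and for $\pi\in P_2^J(p)$ and a block $u=\{r,s\}\in\pi$, $J_u:=J_r=J_s$. $P_2^{J,\alpha}(p)$ is the set of $\pi\in P_2^J(p)$ such that: (1) for every $(u,v)\in E(f_\pi)$, $(l_1,l_2)\in E(g_L)$ for all $(l_1,l_2)\in J_u\times J_v$ with $l_1\neq l_2$; (2) for every block $u=\{r,s\}\in\pi$ with $\alpha_r=\alpha_s$, $(l_1,l_2)\in E(g_L)$ for all distinct $l_1,l_2\in J_u$. Finally, for $I,K\in\mathcal{P}^*(L)$, $w^*_{IK}(x,y)=w(x,y)$ if $I\cap K\neq\varnothing$, and $w^*_{IK}(x,y)=1$ otherwise. *)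

(* Defs.v *)
From HB Require Import structures.
From mathcomp Require Import all_boot all_order all_algebra.
From mathcomp Require Import complex.
From mathcomp Require Import all_classical all_reals all_analysis.

Set Implicit Arguments.
Unset Strict Implicit.
Unset Printing Implicit Defensive.

Import Order.TTheory GRing.Theory Num.Theory.
Import numFieldNormedType.Exports.

Local Open Scope classical_set_scope.
Local Open Scope complex_scope.
Local Open Scope ring_scope.

(** * Noncommutative probability spaces *)

(* The order of R[i] makes [0 <= z] mean that z is real and nonnegative. *)
Record ncProbSpace (R : realType) := NCProbSpace {
  nc_alg :> algType R[i];
  adj : nc_alg -> nc_alg;
  tau : {scalar nc_alg};
  adjK : involutive adj;
  adjD : forall x y, adj (x + y) = adj x + adj y;
  adjZ : forall (c : R[i]) x, adj (c *: x) = c^* *: adj x;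
  adjM : forall x y, adj (x * y) = adj y * adj x;
  tau1 : tau 1 = 1;
  tau_ge0 : forall x, 0 <= tau (adj x * x)
}.

Section NoncommutativeProbability.
Context {R : realType}.
Implicit Types A B : ncProbSpace R.

Definition selfadjoint A (x : A) : Prop := adj x = x.

(* The exponent set {1, *} is encoded by bool, with true standing for *. *)
Definition star_pow A (t : bool) (x : A) : A := if t then adj x else x.

(* Two self-adjoint variables have the same law when their moments agree. *)
Definition same_law A (x y : A) : Prop :=
  forall m : nat, tau A (x ^+ m) = tau A (y ^+ m).

(* Subalgebras are unital. *)
Definition subalgebra A (S : set A) : Prop := GRing.subalg_closed (mem S).

(* The subalgebra generated by x; it is closed under adj if x is
   self-adjoint. *)
Definition generated_by A (x : A) : set A := smallest (@subalgebra A) [set x].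

Definition classically_independent A (S T : set A) : Prop :=
  forall x y, S x -> T y -> x * y = y * x /\ tau A (x * y) = tau A x * tau A y.

Definition cvg_star_distribution A B (b : nat -> A) (z : B) : Prop :=
  forall (k : nat) (t : 'I_k -> bool), (0 < k)%N ->
    (fun n => tau A (\prod_(j < k) star_pow (t j) (b n)) : R[i]^o) @ \oo -->
    (tau B (\prod_(j < k) star_pow (t j) z) : R[i]^o).

End NoncommutativeProbability.

(** * Graphs and graphons *)

Record sgraph (V : finType) := SGraph {
  adjacent :> rel V;
  adjacent_sym : symmetric adjacent;
  adjacent_irr : irreflexive adjacent
}.

(* Each undirected edge is represented once, by its orientation that increases
   along the enumeration of V. *)
Definition edge_of (V : finType) (e : rel V) : pred (V * V) :=
  fun uv => (enum_rank uv.1 < enum_rank uv.2)%N && e uv.1 uv.2.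

Definition graph_independent (R : realType) (A : ncProbSpace R) (V : finType)
    (g : sgraph V) (S : V -> set A) : Prop :=
  (forall i j, g i j -> classically_independent (S i) (S j)) /\
  (forall (k : nat) (i : 'I_k -> V), (0 < k)%N ->
    (forall j1 j2 : 'I_k, (j1 < j2)%N -> i j1 = i j2 ->
      exists2 j3 : 'I_k, (j1 < j3 < j2)%N & ~~ g (i j1) (i j3)) ->
    forall x : 'I_k -> A,
      (forall j, S (i j) (x j)) -> (forall j, tau A (x j) = 0) ->
      tau A (\prod_(j < k) x j) = 0).

Definition graph_independent_variables (R : realType) (A : ncProbSpace R)
    (V : finType) (g : sgraph V) (x : V -> A) : Prop :=
  graph_independent g (fun v => generated_by (x v)).

Record graphon (R : realType) := Graphon {
  graphon_fun :> R -> R -> R;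
  graphon_measurable :
    measurable_fun (`[(0 : R), (1 : R)]%classic `*` `[(0 : R), (1 : R)]%classic)
      (fun xy : R * R => graphon_fun xy.1 xy.2);
  graphon_sym : forall x y, 0 <= x <= 1 -> 0 <= y <= 1 ->
    graphon_fun x y = graphon_fun y x;
  graphon_itv : forall x y, 0 <= x <= 1 -> 0 <= y <= 1 ->
    0 <= graphon_fun x y <= 1
}.

Section UnitCube.
Context {R : realType}.

Let RB : measurableType _ := measurableTypeR R.

Definition cons_pair n (xs : RB * n.-tuple RB) : n.+1.-tuple RB :=
  [the n.+1.-tuple RB of xs.1 :: xs.2].

Lemma measurable_cons_pair n : measurable_fun setT (@cons_pair n).
Proof. exact: measurable_cons measurable_fst measurable_snd. Qed.

HB.instance Definition _ n :=
  isMeasurableFun.Build _ _ _ _ (@cons_pair n) (@measurable_cons_pair n).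

(* The n-fold product of the uniform probability on [0, 1], as a measure on
   R^n. *)
Fixpoint cube_measure n : probability (n.-tuple RB) R :=
  match n with
  | 0 => \d_ [tuple]
  | m.+1 => distribution (uniform_prob (@ltr01 R) \x cube_measure m)%E
              (@cons_pair m)
  end.

Definition unit_cube n : set (n.-tuple RB) :=
  [set x | forall i, 0 <= tnth x i <= 1].

(* The integral over x in [0,1]^V of the product, over the edges (u, v) of e,
   of F u v (x_u) (x_v). The domain is restricted because a graphon is only
   constrained on [0,1]^2. *)
Definition edge_integral (V : finType) (e : rel V)
    (F : V -> V -> R -> R -> R) : R :=
  \int[cube_measure #|V|]_(x in @unit_cube #|V|)
    \prod_(uv | edge_of e uv)
      F uv.1 uv.2 (tnth x (enum_rank uv.1)) (tnth x (enum_rank uv.2)).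

Definition graphon_density (V : finType) (f : sgraph V) (w : graphon R) : R :=
  edge_integral f (fun _ _ => w).

Definition graph_density (V W : finType) (f : sgraph V) (g : sgraph W) : R :=
  (#|W|%:R ^+ #|V|)^-1 *
  \sum_(phi : {ffun V -> W})
    \prod_(uv | edge_of f uv) (g (phi uv.1) (phi uv.2))%:R.

Definition cvg_graphon (g : forall n, sgraph 'I_n) (w : graphon R) : Prop :=
  forall (V : finType) (f : sgraph V),
    (fun n => graph_density f (g n)) @ \oo --> graphon_density f w.

End UnitCube.

(** * Pair partitions and the limiting family *)

Definition nonempty_set (L : nat) := {J : {set 'I_L} | J != finset.set0}.

Section PairPartitions.
Variables (L p : nat).
Implicit Types (pi : {set {set 'I_p}}) (u v : {set 'I_p}).

Definition pair_partition pi : bool :=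
  finset.partition pi [set: 'I_p]%SET && [forall u in pi, #|u| == 2%N].

Definition interlace u v : bool :=
  [exists a in u, exists b in v, exists c in u, exists d in v,
    (a < b < c)%N && (c < d)%N].

Definition crossing u v : bool := interlace u v || interlace v u.

Definition block pi := {u : {set 'I_p} | u \in pi}.

Definition intersection_graph pi : rel (block pi) :=
  fun u v : block pi => crossing (val u) (val v).

Variable J : 'I_p -> nonempty_set L.

Definition label_compatible pi : bool :=
  [forall u in pi, forall r in u, forall s in u, J r == J s].

(* Meaningful when J is constant on u. *)
Definition block_label u : {set 'I_L} :=
  if [pick r in u] is Some r then val (J r) else finset.set0.

Definition admissible_partition (gL : sgraph 'I_L) (alpha : 'I_p -> bool) pi
    : bool :=
  [&& pair_partition pi, label_compatible pi,
      [forall u : block pi, forall v : block pi, intersection_graph u v ==>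
        [forall l1 in block_label (val u), forall l2 in block_label (val v),
          (l1 != l2) ==> gL l1 l2]]
    & [forall u in pi, forall r in u, forall s in u,
        (r != s) && (alpha r == alpha s) ==>
        [forall l1 in block_label u, forall l2 in block_label u,
          (l1 != l2) ==> gL l1 l2]]].

End PairPartitions.

Definition graphon_star (R : realType) (L : nat) (w : graphon R)
    (I K : {set 'I_L}) (x y : R) : R :=
  if I :&: K != finset.set0 then w x y else 1.

Definition partition_integral (R : realType) (L p : nat) (w : graphon R)
    (J : 'I_p -> nonempty_set L) (pi : {set {set 'I_p}}) : R :=
  edge_integral (@intersection_graph p pi)
    (fun u v => graphon_star w (block_label J (val u)) (block_label J (val v))).

Definition limit_joint_law (R : realType) (L : nat) (gL : sgraph 'I_L)
    (w : graphon R) (B : ncProbSpace R) (s : nonempty_set L -> B) : Prop :=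
  forall (p : nat) (J : 'I_p -> nonempty_set L) (alpha : 'I_p -> bool),
    (0 < p)%N ->
    tau B (\prod_(r < p) star_pow (alpha r) (s (J r))) =
    (\sum_(pi : {set {set 'I_p}} | admissible_partition J gL alpha pi)
       partition_integral w J pi)%:C.

Definition normalized_sum (R : realType) (A : ncProbSpace R) (L n : nat)
    (lambda : R) (x : 'I_n -> 'I_L -> A) : A :=
  ((Num.sqrt n%:R)^-1 : R)%:C *:
    \sum_(k < n) (\prod_(l < L) x k l - (lambda ^+ L)%:C%:A).

(* Main.v *)
(* By multilinearity, S_n is a combination of the sums over k of products of
   the centered variables x_k^(l) - lambda, l in J, so everything reduces to
   moments of words in centered letters indexed by pairs (k, l). The subalgebras
   generated by the x_k^(l) are again independent in the graph sense, for the
   graph joining (k, l) and (k', l') according to g'_n if l = l' and to g_L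
   otherwise: blocks of letters with the same l can be merged without affecting
   reducedness. Merging two occurrences of a letter separated only by letters
   adjacent to it then shows that a word with a letter occurring exactly once
   has moment 0, that a word in which every letter occurs twice has moment
   sigma^length or 0 according to whether all crossing pairs are adjacent, and
   that moments are bounded uniformly in n. In the p-th moment only the indices
   k whose kernel is a pair partition survive in the limit, and they produce
   homomorphism densities in g'_n, which converge by assumption; no integral
   ever has to be computed.

   Since sigma or lambda may vanish, the limit family cannot be extracted from
   S_n. It is realized on a free algebra; positivity of the limit functional
   follows by running the same limit theorem on a concrete model, in which the
   letters are involutions of a product of copies of S_3 and the state of a word
   is 1 if the word is trivial and 0 otherwise. *)
Require Import Defs.
From HB Require Import structures.
From mathcomp Require Import all_boot all_order all_algebra.
From mathcomp Require Import fingroup perm finmap complex.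
From mathcomp Require Import monalg.
From mathcomp Require Import all_classical all_reals all_analysis.
From mathcomp Require Import zify.

Set Implicit Arguments.
Unset Strict Implicit.
Unset Printing Implicit Defensive.

Import Order.TTheory GRing.Theory Num.Theory.
Import numFieldNormedType.Exports.

Local Open Scope classical_set_scope.
Local Open Scope complex_scope.
Local Open Scope ring_scope.

(** * Words over a graph *)

Section Words.
Variables (V : eqType) (e : rel V).
Hypotheses (e_sym : symmetric e) (e_irr : irreflexive e).

(* A letter a can be merged with its next occurrence exactly when all letters
   in between are adjacent to a; guarded a w says that this does not happen
   when a is put in front of w. *)
Fixpoint guarded (a : V) (w : seq V) : bool :=
  if w is b :: w' then (b != a) && (e a b ==> guarded a w') else true.

Fixpoint reduced (w : seq V) : bool :=
  if w is a :: w' then guarded a w' && reduced w' else true.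

Lemma adjacent_neq a b : e a b -> a != b.
Proof. by move=> eab; apply/eqP => ab; rewrite ab e_irr in eab. Qed.

Lemma guarded_swap c a b w : e a b ->
  guarded c [:: a, b & w] = guarded c [:: b, a & w].
Proof.
move=> eab /=; have eba : e b a by rewrite e_sym.
have [ac|nac] /= := eqVneq a c.
  by rewrite -ac eab (eq_sym b) (adjacent_neq eab).
have [bc|nbc] /= := eqVneq b c; first by rewrite -bc eba.
by case: (e c a); case: (e c b).
Qed.

(** [guarded c] stops at the first letter that equals [c] or is not adjacent to it, and exchanging
    two adjacent letters does not change whether [c] is found first. Reducedness is thus a property
    of words up to commutation of adjacent letters. *)
Lemma reduced_swap a b P Q : e a b ->
  reduced (P ++ [:: a, b & Q]) = reduced (P ++ [:: b, a & Q]).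
Proof.
move=> eab; elim: P => [|c P IH].
  have nab := adjacent_neq eab.
  rewrite /= eab e_sym eab nab eq_sym nab /=.
  by rewrite andbCA.
rewrite /= IH; congr (_ && _); elim: P {IH} => [|d P IH].
  exact: guarded_swap.
by rewrite /= IH.
Qed.

Lemma reduced_move P M B Q : allrel e M B ->
  reduced (P ++ M ++ B ++ Q) = reduced (P ++ B ++ M ++ Q).
Proof.
have move1 a : forall B P Q, all (e a) B ->
    reduced (P ++ a :: B ++ Q) = reduced (P ++ B ++ a :: Q).
  elim=> [//|b B' IH] P' Q' /= /andP[eab eaB].
  by rewrite reduced_swap // -!(cat_rcons b) IH.
elim: M P => [//|a M IH] P; rewrite allrel_consl => /andP[eaB eMB] /=.
by rewrite -cat_rcons IH // cat_rcons move1.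
Qed.

Lemma reduced_infix P B Q : reduced (P ++ B ++ Q) -> reduced B.
Proof.
elim: P => [|a P IH] /=; last by case/andP=> _; exact: IH.
elim: B => [//|b B IH] /= /andP[gb /IH ->]; rewrite andbT.
elim: B {IH} gb => [//|c B IH] /= /andP[-> /implyP h] /=.
by apply/implyP => /h; exact: IH.
Qed.

(** The map [f] lets the letters carry extra data, so that the two mergeable occurrences are
    returned together with what they carry. *)
Lemma not_reduced (X : Type) (f : X -> V) (w : seq X) :
  ~~ reduced (map f w) ->
  exists P b M c Q, [/\ w = P ++ b :: M ++ c :: Q, f b = f c &
                        all (e (f b)) (map f M)].
Proof.
elim: w => [//|a w IH] /=; rewrite negb_and => /orP[gw|].
  suff [M [c [Q [-> fc aM]]]] : exists M c Q,
      [/\ w = M ++ c :: Q, f a = f c & all (e (f a)) (map f M)].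
    by exists [::], a, M, c, Q.
  elim: w gw {IH} => [//|b w IH] /=; rewrite negb_and negbK negb_imply.
  case/orP=> [/eqP fb|/andP[eab /IH[M [c [Q [-> fc aM]]]]]].
    by exists [::], b, w.
  by exists (b :: M), c, Q; rewrite /= eab.
case/IH=> P [b [M [c [Q [-> fb aM]]]]].
by exists (a :: P), b, M, c, Q.
Qed.

Lemma guardedPn a w x0 : guarded a w -> forall j, (j < size w)%N ->
  nth x0 w j = a -> exists2 i, (i < j)%N & ~~ e a (nth x0 w i).
Proof.
elim: w => [//|b w IH] /= /andP[nba /implyP h] [|j] /=.
  by move=> _ ba; rewrite ba eqxx in nba.
rewrite ltnS => js wj; have [/h gw|neab] := boolP (e a b); last by exists 0%N.
by have [i ij nei] := IH gw j js wj; exists i.+1.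
Qed.

(** Translates the recursive definition into the condition on index sequences that appears in graph
    independence. *)
Lemma reducedP x0 w : reduced w ->
  forall j1 j2, (j1 < j2 < size w)%N -> nth x0 w j1 = nth x0 w j2 ->
  exists2 j3, (j1 < j3 < j2)%N & ~~ e (nth x0 w j1) (nth x0 w j3).
Proof.
elim: w => [|a w IH] /=; first by move=> _ ? ?; rewrite ltn0 andbF.
case/andP=> gw rw [|j1] [|j2] //=; rewrite !ltnS => j12 eqj.
  have [i ij nei] := guardedPn gw j12 (esym eqj).
  by exists i.+1.
by have [j3 j3b nej] := IH rw j1 j2 j12 eqj; exists j3.+1.
Qed.

(* Take the shortest prefix with a repeated letter v: every letter strictly
   between the two occurrences of v has its second occurrence further on. *)
Lemma reduced_crossing (w : seq V) : w != [::] -> reduced w ->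
  (forall v, v \in w -> count_mem v w = 2%N) ->
  exists u v, subseq [:: u; v; u; v] w /\ ~~ e u v.
Proof.
move=> w0 rw cw.
have [P [v [Q [wE uP vP]]]] : exists P v Q,
    [/\ w = P ++ v :: Q, uniq P & v \in P].
  have nuw : ~~ uniq w.
    case: w w0 rw cw => // a w _ _ cw.
    apply/negP => /count_uniq_mem u2.
    by have := cw a; rewrite u2 mem_head => /(_ isT).
  elim/last_ind: w nuw {w0 rw cw} => [//|w a IH].
  rewrite rcons_uniq negb_and negbK; have [uw|nuw] := boolP (uniq w).
    by rewrite orbF => aw; exists w, a, [::]; rewrite cats1.
  move=> _; have [P [v [Q [-> uP vP]]]] := IH nuw.
  by exists P, v, (rcons Q a); rewrite -rcons_cons rcons_cat.
have /path.splitPr PE := vP; case: PE uP wE vP => P1 M uP wE _.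
have /reduced_infix rvMv : reduced (P1 ++ (v :: rcons M v) ++ Q).
  by rewrite /= cat_rcons; move: rw; rewrite wE -catA.
have [x xM nevx] : exists2 x, x \in M & ~~ e v x.
  move: rvMv => /= /andP[g _]; elim: M g {uP wE} => [|x M IH] /=.
    by rewrite eqxx.
  case/andP=> _ /implyP h; have [/h /IH [y yM ney]|nex] := boolP (e v x).
    by exists y; rewrite // inE yM orbT.
  by exists x; rewrite // inE eqxx.
exists v, x; split=> //.
have xQ : x \in Q.
  have xw : x \in w by rewrite wE -catA !mem_cat /= !inE xM !orbT.
  have xnv : x != v.
    apply/eqP => xv; move: uP; rewrite cat_uniq /= -xv xM /=.
    by rewrite !andbF.
  move: (cw x xw); rewrite wE count_cat /= (count_uniq_mem _ uP).
  rewrite mem_cat inE xM !orbT eq_sym (negPf xnv) /=.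
  by rewrite -has_pred1 has_count; case: (count _ Q).
rewrite wE -catA; apply: (subseq_trans _ (suffix_subseq _ _)).
rewrite /= eqxx -[[:: x; v; x]]/([:: x] ++ [:: v; x]).
by apply: cat_subseq; rewrite ?sub1seq //= eqxx sub1seq.
Qed.

End Words.

(** * Independence of nested families *)

Section WordIndependence.
Context {R : realType} (A : ncProbSpace R).

(** Graph independence in the form used on words: each letter carries its index and its element,
    adjacency enters through commutation, and [reduced] replaces the condition on indices. *)
Definition word_independent (V : eqType) (e : rel V) (S : V -> set A) : Prop :=
  (forall u v, e u v -> forall x y, S u x -> S v y -> x * y = y * x) /\
  (forall w : seq (V * A), w != [::] -> reduced e (unzip1 w) ->
     (forall b, b \in w -> S b.1 b.2 /\ tau A b.2 = 0) ->
     tau A (\prod_(b <- w) b.2) = 0).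

Lemma graph_word_independent (V : finType) (g : sgraph V) (S : V -> set A) :
  graph_independent g S -> word_independent g S.
Proof.
case=> g1 g2; split=> [u v guv x y Sx Sy|w w0 rw hw].
  by have [] := g1 u v guv x y Sx Sy.
case: w w0 rw hw => // b w _ rw hw.
set n := size (b :: w); have n0 : (0 < n)%N by [].
have := g2 n (fun j => (nth b (b :: w) j).1) n0 _ (fun j => (nth b (b :: w) j).2).
rewrite [\prod_(j < _) _](_ : _ = \prod_(c <- b :: w) c.2); last first.
  by rewrite [RHS](big_nth b) big_mkord.
apply=> [j1 j2 j12 eqj|j|j].
- have := @reducedP _ g b.1 _ rw j1 j2; rewrite size_map j12 ltn_ord.
  rewrite !(nth_map b) ?ltn_ord // => /(_ isT eqj) [j3 j3b].
  have j3n : (j3 < n)%N by apply: ltn_trans (ltn_ord j2); case/andP: j3b.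
  rewrite (nth_map b) // => nej.
  by exists (Ordinal j3n).
- by have [] := hw (nth b (b :: w) j) (mem_nth _ (ltn_ord j)).
- by have [] := hw (nth b (b :: w) j) (mem_nth _ (ltn_ord j)).
Qed.

Lemma comm_prod_seq (X Y : eqType) (f : X -> A) (h : Y -> A) (s : seq X) (t : seq Y) :
  {in s & t, forall x y, f x * h y = h y * f x} ->
  (\prod_(x <- s) f x) * (\prod_(y <- t) h y) =
  (\prod_(y <- t) h y) * (\prod_(x <- s) f x).
Proof.
move=> fh; rewrite big_seq [\prod_(y <- t) _]big_seq.
apply: commr_prod => y yt; apply: commr_sym; apply: commr_prod => x xs.
by apply: commr_sym; exact: fh.
Qed.

End WordIndependence.

Section Nested.
Context {R : realType} (A : ncProbSpace R).
Variables (I K : eqType) (eI : rel I) (eK : rel K).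
Hypotheses (eI_sym : symmetric eI) (eI_irr : irreflexive eI).
Hypotheses (eK_sym : symmetric eK) (eK_irr : irreflexive eK).

(** The lexicographic product of the two graphs, with the [I]-coordinate dominant. *)
Definition nested_adjacent : rel (K * I) :=
  fun u v => if u.2 == v.2 then eK u.1 v.1 else eI u.2 v.2.

Lemma nested_adjacent_sym : symmetric nested_adjacent.
Proof. by move=> u v; rewrite /nested_adjacent eq_sym eK_sym eI_sym. Qed.

Lemma nested_adjacent_irr : irreflexive nested_adjacent.
Proof. by move=> u; rewrite /nested_adjacent eqxx eK_irr. Qed.

Lemma nested_reduced (l : I) (w : seq K) :
  reduced nested_adjacent [seq (k, l) | k <- w] = reduced eK w.
Proof.
have nadjE k k' : nested_adjacent (k, l) (k', l) = eK k k'.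
  by rewrite /nested_adjacent /= eqxx.
elim: w => [//|k w IH] /=; rewrite IH; congr (_ && _).
by elim: w {IH} => [//|k' w IH] /=; rewrite IH xpair_eqE eqxx andbT nadjE.
Qed.

Variables (S : I -> set A) (T : K * I -> set A).
Hypothesis S_alg : forall l, subalgebra (S l).
Hypothesis TS : forall k l, T (k, l) `<=` S l.
Hypothesis S_indep : word_independent eI S.
Hypothesis T_indep : forall l, word_independent eK (fun k => T (k, l)).

(** [bs] is a word cut into blocks that share an index in [I]; expanding forgets the cuts. *)
Let expand (bs : seq (I * seq (K * A))) : seq (K * I * A) :=
  flatten [seq [seq (x.1, b.1, x.2) | x <- b.2] | b <- bs].

Let expand_cat bs cs : expand (bs ++ cs) = expand bs ++ expand cs.
Proof. by rewrite /expand map_cat flatten_cat. Qed.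

Let expand_cons b bs : expand (b :: bs) =
  [seq (x.1, b.1, x.2) | x <- b.2] ++ expand bs.
Proof. by []. Qed.

(* A word is cut into blocks with constant I-index. When the word of blocks is
   not reduced, two blocks can be merged without affecting reducedness of the
   expanded word; when it is reduced, each block is centered. *)
Lemma nested_blocks N (bs : seq (I * seq (K * A))) :
  (size bs <= N)%N -> bs != [::] -> (forall b, b \in bs -> b.2 != [::]) ->
  reduced nested_adjacent (unzip1 (expand bs)) ->
  (forall b, b \in expand bs -> T b.1 b.2 /\ tau A b.2 = 0) ->
  tau A (\prod_(b <- expand bs) b.2) = 0.
Proof.
elim: N bs => [[]//|N IH] bs bsN bs0 bsne rbs hbs.
have [r|] := boolP (reduced eI [seq b.1 | b <- bs]).
  pose w := [seq (b.1, \prod_(x <- b.2) x.2) | b <- bs].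
  have -> : \prod_(b <- expand bs) b.2 = \prod_(b <- w) b.2.
    rewrite /expand big_flatten !big_map; apply: eq_bigr => b _ /=.
    by rewrite big_map.
  apply: (proj2 S_indep).
  - by rewrite -size_eq0 size_map size_eq0.
  - by rewrite /unzip1 -map_comp (eq_map (g := fst)).
  move=> _ /mapP[b /path.splitPr bP ->] /=.
  case: bP bsN bs0 bsne rbs hbs r => P Q _ _ bsne rbs hbs _.
  have hb x : x \in b.2 -> T (x.1, b.1) x.2 /\ tau A x.2 = 0.
    move=> xb; apply: (hbs (x.1, b.1, x.2)).
    by rewrite expand_cat expand_cons !mem_cat map_f ?orbT.
  split.
    elim: (b.2) hb => [|x t IHt] hb; rewrite ?big_nil ?big_cons.
      have [+ _ _] := S_alg b.1; by rewrite !inE.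
    have [_ _] := S_alg b.1; move=> /(_ x.2 (\prod_(j <- t) j.2)).
    rewrite !inE; apply; first by apply: TS; apply: (hb x _).1; rewrite mem_head.
    by apply: IHt => y yt; apply: hb; rewrite inE yt orbT.
  (* A block is a factor of the reduced expanded word, hence reduced for [eK], so its product is
     centered. *)
  apply: (proj2 (T_indep b.1)) => //.
    by apply: bsne; rewrite mem_cat mem_head orbT.
  rewrite -(nested_reduced b.1); move: rbs; rewrite expand_cat expand_cons.
  rewrite /unzip1 !map_cat => /reduced_infix.
  by rewrite -!map_comp.
case/not_reduced=> P [b [M [c [Q [bsE bc aM]]]]].
pose cs := P ++ (b.1, b.2 ++ c.2) :: M ++ Q.
pose X := [seq (x.1, b.1, x.2) | x <- c.2].
have bsX : expand bs = (expand P ++ [seq (x.1, b.1, x.2) | x <- b.2]) ++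
    expand M ++ X ++ expand Q.
  by rewrite bsE expand_cat expand_cons expand_cat expand_cons -/X -bc -catA.
have csX : expand cs = (expand P ++ [seq (x.1, b.1, x.2) | x <- b.2]) ++
    X ++ expand M ++ expand Q.
  by rewrite expand_cat expand_cons expand_cat /= map_cat -!catA.
(* By irreflexivity an index adjacent to [b.1] differs from it, so the dominant coordinate alone
   decides adjacency here. *)
have MX : allrel nested_adjacent (unzip1 (expand M)) (unzip1 X).
  apply/allrelP => u v /mapP[x /flatten_mapP[d dM /mapP[y yd ->]] ->] /=.
  case/mapP=> _ /mapP[z zc ->] -> /=.
  have : eI b.1 d.1 by apply: (allP aM); rewrite map_f.
  rewrite /nested_adjacent /= eI_sym; case: eqP => // ->; by rewrite eI_irr.
have -> : \prod_(b <- expand bs) b.2 = \prod_(b <- expand cs) b.2.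
  rewrite bsX csX !big_cat /= !mulrA; congr (_ * _); rewrite -!mulrA.
  congr (_ * (_ * _)); apply: comm_prod_seq.
  have memS z : z \in expand bs -> S z.1.2 z.2.
    by case: z => [[k l] z] /hbs[/TS].
  move=> x y xM yX; apply: (proj1 S_indep x.1.2 y.1.2); last first.
  - by apply: memS; rewrite bsX !mem_cat yX !orbT.
  - by apply: memS; rewrite bsX !mem_cat xM !orbT.
  have /flatten_mapP[d dM /mapP[z zd ->]] := xM.
  have /mapP[t tc ->] := yX; rewrite /= eI_sym.
  by apply: (allP aM); rewrite map_f.
apply: IH.
- by move: bsN; rewrite bsE !size_cat /= !size_cat /= !addnS !ltnS.
- by rewrite /cs; case: (P).
- move=> d; rewrite /cs mem_cat inE mem_cat => hd.
  have [->|nd] /= := eqVneq d (b.1, b.2 ++ c.2).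
    have := bsne b; rewrite bsE mem_cat inE eqxx orbT => /(_ isT).
    by case: (b.2).
  apply: bsne; rewrite bsE mem_cat inE mem_cat inE.
  by move: hd; rewrite (negPf nd) /= => /or3P[] ->; rewrite ?orbT.
- move: rbs; rewrite bsX csX /unzip1 !map_cat reduced_move //.
    exact: nested_adjacent_sym.
  exact: nested_adjacent_irr.
- move=> x xcs; apply: hbs; move: xcs; rewrite bsX csX !mem_cat.
  by case: (x \in expand M); rewrite ?orbT ?orTb.
Qed.

(** The merging of blocks is started from the finest cutting, with one letter per block. *)
Lemma nested_independent : word_independent nested_adjacent T.
Proof.
split=> [[k l] [k' l']|w w0 rw hw].
  rewrite /nested_adjacent /=; case: eqVneq => [<-|_] /=.
    exact: (proj1 (T_indep l)).
  by move=> ell x y /TS Sx /TS Sy; apply: (proj1 S_indep _ _ ell).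
pose blocks := map (fun b : K * I * A => (b.1.2, [:: (b.1.1, b.2)])).
have bsE s : expand (blocks s) = s.
  elim: s => [//|[[k l] x] s IH].
  by rewrite /blocks map_cons expand_cons -/(blocks s) IH.
rewrite -(bsE w); apply: (nested_blocks (leqnn _)); rewrite ?bsE //.
  by rewrite -size_eq0 size_map size_eq0.
by move=> b /mapP[c _ ->].
Qed.

End Nested.

(** * Moments of words in centered letters *)

(** When every letter occurs twice, the pattern u v u v says that the pairs of u and v cross. *)
Definition crossings_adjacent (V : eqType) (e : rel V) (w : seq V) : Prop :=
  forall u v, subseq [:: u; v; u; v] w -> e u v.

Section PairRemoval.
Variables (V : eqType) (e : rel V).
Hypotheses (e_sym : symmetric e) (e_irr : irreflexive e).

Lemma subseq_cat_notin (x : V) (s P Q : seq V) : x \notin P ->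
  subseq (x :: s) (P ++ Q) = subseq (x :: s) Q.
Proof.
by elim: P => [//|y P IH] /=; rewrite inE negb_or => /andP[/negPf-> /IH].
Qed.

(** A pair that crosses the pair of [v] has a letter in [M], which is adjacent to [v] by assumption;
    crossings between the other pairs are not affected by the removal. *)
Lemma crossings_adjacent_remove (P : seq V) v (M Q : seq V) :
  v \notin P ++ M ++ Q -> all (e v) M ->
  crossings_adjacent e (P ++ v :: M ++ v :: Q) <->
  crossings_adjacent e (P ++ M ++ Q).
Proof.
move=> vn vM.
have sub : subseq (P ++ M ++ Q) (P ++ v :: M ++ v :: Q).
  apply: cat_subseq => //; apply: (subseq_trans _ (subseq_cons _ v)).
  by apply: cat_subseq => //; exact: subseq_cons.
split=> h a b abw; first by apply: h; exact: subseq_trans sub.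
have half (P' M' Q' : seq V) u : v \notin P' -> v \notin M' -> v \notin Q' ->
    subseq [:: v; u; v; u] (P' ++ v :: M' ++ v :: Q') -> u \in M'.
  move=> vP' vM' vQ'; rewrite subseq_cat_notin //= eqxx => s1.
  apply: contraT => uM'; move: s1; rewrite subseq_cat_notin //=.
  case: eqP => [_|_] /mem_subseq /(_ v); rewrite !inE eqxx ?orbT (negPf vQ').
    by move/(_ isT).
  by move/(_ isT).
move: (vn); rewrite !mem_cat !negb_or => /and3P[vP nvM vQ].
have [av|nav] := eqVneq a v.
  by rewrite av in abw *; apply: (allP vM); exact: half abw.
have [bv|nbv] := eqVneq b v.
  rewrite bv e_sym; apply: (allP vM); rewrite -mem_rev.
  (* The pattern that ends with [v] becomes one that starts with [v] after reversing the word. *)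
  apply: (half (rev Q) (rev M) (rev P)); rewrite ?mem_rev //.
  have := abw; rewrite bv -(subseq_rev [:: a; v; a; v]).
  by rewrite !(rev_cat, rev_cons) -!cats1 -!catA.
apply: h.
have -> : P ++ M ++ Q = [seq x <- P ++ v :: M ++ v :: Q | x != v].
  rewrite filter_cat /= eqxx /= filter_cat /= eqxx /=.
  by congr (_ ++ (_ ++ _)); apply/esym/all_filterP/allP => x xP;
    apply: contraNneq vn => <-; rewrite !mem_cat xP ?orbT.
by rewrite subseq_filter /= nav nbv.
Qed.

End PairRemoval.

Section Moments.
Context {R : realType} (A : ncProbSpace R).
Variables (V : eqType) (e : rel V) (S : V -> set A).
Hypotheses (e_sym : symmetric e) (e_irr : irreflexive e).
Hypothesis S_alg : forall v, subalgebra (S v).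
Hypothesis S_indep : word_independent e S.

(** All letters of [M] are adjacent to the repeated index, so [c] commutes to the left until it
    meets [b]. *)
Lemma prod_merge (P : seq (V * A)) b M c Q :
  b.1 = c.1 -> all (e b.1) (unzip1 M) ->
  (forall x, x \in M -> S x.1 x.2) -> S c.1 c.2 ->
  \prod_(x <- P ++ b :: M ++ c :: Q) x.2 =
  \prod_(x <- P) x.2 * (b.2 * c.2) * \prod_(x <- M ++ Q) x.2.
Proof.
move=> bc aM SM Sc; rewrite big_cat big_cons big_cat big_cons /=.
rewrite -!mulrA big_cat /=; congr (_ * (_ * _)); rewrite !mulrA; congr (_ * _).
rewrite -[c.2](big_seq1 *%R c (fun c => c.2)); apply: comm_prod_seq.
move=> x y xM; rewrite inE => /eqP ->.
apply: (proj1 S_indep x.1 c.1); [|exact: SM|exact: Sc].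
by rewrite e_sym -bc (allP aM) // map_f.
Qed.

Lemma subalgebra_mul v x y : S v x -> S v y -> S v (x * y).
Proof.
by move=> Sx Sy; have [_ _ /(_ x y)] := S_alg v; rewrite !inE; apply.
Qed.

Lemma subalgebra_center v x c : S v x -> S v (x - c%:A).
Proof.
move=> Sx; have [] := S_alg v; rewrite inE => S1 /(_ (- c) 1 x) + _.
by rewrite !inE scaleNr addrC; apply.
Qed.

Lemma tau_scalar c : tau A (c%:A) = c.
Proof. by rewrite linearZ /= tau1 mulr1. Qed.

(* Merging two letters produces a centered letter and a scalar; neither
   affects a letter occurring exactly once. *)
Lemma tau_singleton v (w : seq (V * A)) :
  (forall b, b \in w -> S b.1 b.2 /\ tau A b.2 = 0) ->
  count_mem v (unzip1 w) = 1%N -> tau A (\prod_(b <- w) b.2) = 0.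
Proof.
move: {2}(size w) (leqnn (size w)) => N.
elim: N w => [|N IH] w; first by case: w.
move=> wN hw cw; have [r|] := boolP (reduced e (unzip1 w)).
  by apply: (proj2 S_indep) => //; apply/eqP => w0; rewrite w0 in cw.
case/not_reduced=> P [b [M [c [Q [wE bc aM]]]]].
have bw : b \in w by rewrite wE mem_cat inE eqxx !orbT.
have cw' : c \in w by rewrite wE mem_cat inE mem_cat inE eqxx !orbT.
have Mw x : x \in M -> x \in w by rewrite wE mem_cat inE mem_cat => ->; rewrite !orbT.
have Pw x : x \in P -> x \in w by rewrite wE mem_cat => ->.
have Qw x : x \in Q -> x \in w.
  by rewrite wE mem_cat inE mem_cat inE => ->; rewrite !orbT.
rewrite wE prod_merge //; last 2 first.
- by move=> x /Mw /hw[].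
- by case: (hw c cw').
set t := tau A (b.2 * c.2).
have -> : b.2 * c.2 = (b.2 * c.2 - t%:A) + t%:A by rewrite subrK.
rewrite mulrDr mulrDl linearD /=.
move: cw; rewrite wE /unzip1 map_cat count_cat /= map_cat count_cat /= -bc => cw.
(* The merged index occurs at least twice, so it is not the singleton. *)
have nb : (b.1 == v) = false.
  by apply/eqP => bv; move: cw; rewrite bv eqxx; lia.
rewrite nb /= !add0n in cw.
set d := (b.1, b.2 * c.2 - t%:A).
have -> : tau A (\prod_(x <- P) x.2 * (b.2 * c.2 - t%:A) * \prod_(x <- M ++ Q) x.2) = 0.
  have /= := IH (P ++ d :: M ++ Q); rewrite big_cat big_cons /= mulrA; apply.
  - by move: wN; rewrite wE !size_cat /= !size_cat /= !addnS !ltnS.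
  - move=> x; rewrite mem_cat inE mem_cat => /or4P[/Pw/hw//|/eqP->|/Mw/hw//|/Qw/hw//].
    split=> /=; last by rewrite linearB /= tau_scalar subrr.
    apply: subalgebra_center; apply: subalgebra_mul; first by case: (hw b bw).
    by rewrite bc; case: (hw c cw').
  - by rewrite /unzip1 map_cat count_cat /= map_cat count_cat nb.
rewrite add0r -scalerAr -scalerAl mulr1 linearZ /= -big_cat /= IH ?mulr0 //.
- by move: wN; rewrite wE !size_cat /= !size_cat /=; lia.
- by move=> x; rewrite !mem_cat => /or3P[/Pw/hw//|/Mw/hw//|/Qw/hw//].
- by rewrite /unzip1 !map_cat !count_cat.
Qed.

Variables (y : V -> A) (s : R[i]).
Hypothesis Sy : forall v, S v (y v).
Hypothesis y_centered : forall v, tau A (y v) = 0.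

Lemma tau_letter_singleton v (w : seq V) : count_mem v w = 1%N ->
  tau A (\prod_(u <- w) y u) = 0.
Proof.
move=> cw; have := @tau_singleton v [seq (u, y u) | u <- w].
rewrite big_map /unzip1 -map_comp map_id; apply=> // b /mapP[u _ ->] /=.
by split.
Qed.

Hypothesis y_variance : forall v, tau A (y v * y v) = s ^+ 2.

(** A nonempty reduced word has moment 0 and, by [reduced_crossing], a crossing that is not
    adjacent. Otherwise some pair can be merged: the centered part of its square is a letter
    occurring once and contributes nothing, while the scalar [s ^+ 2] leaves the word without this
    pair, for which the crossing condition is the same. *)
Lemma tau_letter_pairs (w : seq V) : (forall v, v \in w -> count_mem v w = 2%N) ->
  tau A (\prod_(u <- w) y u) =
  if `[< crossings_adjacent e w >] then s ^+ size w else 0.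
Proof.
move: {2}(size w) (leqnn (size w)) => N.
elim: N w => [|N IH] w wN cw.
  case: w wN {cw} => // _; rewrite big_nil tau1; case: asboolP => // -[].
  by move=> u v.
have [w0|w0] := eqVneq w [::].
  rewrite w0 big_nil tau1; case: asboolP => // -[].
  by move=> u v.
have [r|] := boolP (reduced e w).
  case: asboolP => [ca|_].
    have [u [v [uv nuv]]] := reduced_crossing w0 r cw.
    by rewrite (ca u v uv) in nuv.
  have := (proj2 S_indep) [seq (u, y u) | u <- w].
  rewrite big_map /unzip1 -map_comp map_id; apply=> //.
    by rewrite -size_eq0 size_map size_eq0.
  by move=> b /mapP[u _ ->] /=.
rewrite -{1}[w]map_id => /not_reduced[P [v [M [v' [Q [wE /= vv' aM]]]]]].
rewrite -{v'}vv' map_id in wE aM.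
have vn : v \notin P ++ M ++ Q.
  apply/count_memPn; have := cw v.
  rewrite wE !(mem_cat, inE) eqxx orbT => /(_ isT).
  by rewrite !count_cat /= !count_cat /= eqxx; lia.
have ce : `[< crossings_adjacent e w >] = `[< crossings_adjacent e (P ++ M ++ Q) >].
  by apply: asbool_equiv_eq; rewrite wE; exact: crossings_adjacent_remove.
have prodw t : \prod_(x <- [seq (u, y u) | u <- P] ++ (v, t) ::
    [seq (u, y u) | u <- M ++ Q]) x.2 =
    \prod_(u <- P) y u * t * \prod_(u <- M ++ Q) y u.
  by rewrite big_cat big_cons !big_map /= mulrA.
have -> : \prod_(u <- w) y u =
    \prod_(u <- P) y u * (y v * y v) * \prod_(u <- M ++ Q) y u.
  transitivity (\prod_(x <- [seq (u, y u) | u <- P] ++ (v, y v) ::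
      [seq (u, y u) | u <- M] ++ (v, y v) :: [seq (u, y u) | u <- Q]) x.2).
    by rewrite wE !big_cat !big_cons !big_cat !big_cons !big_map.
  rewrite prod_merge //=; first by rewrite -map_cat !big_map.
    by rewrite /unzip1 -map_comp map_id.
  by move=> x /mapP[u _ ->].
have -> : y v * y v = (y v * y v - (s ^+ 2)%:A) + (s ^+ 2)%:A by rewrite subrK.
rewrite mulrDr mulrDl linearD /= -prodw (@tau_singleton v) ?add0r.
- rewrite -scalerAr -scalerAl mulr1 linearZ /= -big_cat /= IH.
  + rewrite ce; case: asboolP => _; rewrite ?mulr0 // -exprD; congr (_ ^+ _).
    by rewrite wE !size_cat /= !size_cat /=; lia.
  + by move: wN; rewrite wE !size_cat /= !size_cat /=; lia.
  + move=> u uw; have uv : u != v by apply: contraNneq vn => <-.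
    have := cw u; rewrite wE !(mem_cat, inE) (negPf uv).
    rewrite !count_cat /= !count_cat /= (eq_sym v u) (negPf uv) !add0n; apply.
    by move: uw; rewrite !mem_cat.
- move=> b; rewrite mem_cat inE => /or3P[/mapP[u _ ->]|/eqP->|/mapP[u _ ->]];
    split=> //=; last by rewrite linearB /= tau_scalar y_variance subrr.
  by apply: subalgebra_center; exact: subalgebra_mul.
- rewrite /unzip1 map_cat /= -!map_comp !map_id count_cat /= eqxx.
  move: vn; rewrite mem_cat negb_or => /andP[/count_memPn -> /count_memPn ->].
  by [].
Qed.

End Moments.

(** * Bounds on moments that are uniform in the index set *)

Lemma sub_cancel (U : zmodType) (a b c d f : U) :
  a - b - (c - d) = (a - f) - (c - d) - (b - d) + (f - d).
Proof.
by rewrite -[RHS]addrA (opprB b) [d - b + _]addrC subrKA [RHS]addrAC subrKA.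
Qed.

Section MomentBound.
Context {R : realType}.
Variable mu : nat -> R[i].

(* The moments of a word of centered powers are controlled by induction on
   its length, since merging two letters produces shorter words. The point is
   that the bound does not depend on the index set of the family. *)
Lemma tau_powers_bound (N D : nat) : exists2 C : R[i], 1 <= C &
  forall (A : ncProbSpace R) (V : eqType) (e : rel V) (S : V -> set A)
    (y : V -> A),
    symmetric e -> (forall v, subalgebra (S v)) -> word_independent e S ->
    (forall v, S v (y v)) -> (forall v m, tau A (y v ^+ m) = mu m) ->
  forall w : seq (V * nat), (size w <= N)%N -> all (fun b => b.2 <= D)%N w ->
  `|tau A (\prod_(b <- w) (y b.1 ^+ b.2 - (mu b.2)%:A))| <= C.
Proof.
elim: N D => [|N IH] D.
  exists 1 => // A V e S y _ _ _ _ _ [|//] _ _.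
  by rewrite big_nil tau1 normr1.
(* Merging adds exponents, so the shorter words have degree at most [D + D]. *)
have [C C1 hC] := IH (D + D)%N.
pose K := \sum_(m < (D + D).+1) `|mu m|.
have K0 : 0 <= K by apply: sumr_ge0.
have muK m : (m <= D + D)%N -> `|mu m| <= K.
  move=> mD; rewrite /K (bigD1 (Ordinal (mD : (m < (D + D).+1)%N))) //=.
  by rewrite lerDl sumr_ge0.
have C0 : 0 <= C by apply: le_trans C1.
(* This is the total weight of the four terms into which a product of two centered powers expands:
   coefficient 1, two coefficients bounded by [K], and a scalar bounded by [K + K * K]. *)
have E1 : 1 <= 1 + K + K + (K + K * K).
  by rewrite -!addrA lerDl !addr_ge0 // mulr_ge0.
have CC : C <= C * (1 + K + K + (K + K * K)) by apply: ler_peMr.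
exists (C * (1 + K + K + (K + K * K))) => [|A V e S y e_sym S_alg S_ind Sy ymu w wN wD].
  exact: le_trans CC.
pose ev (b : V * nat) := y b.1 ^+ b.2 - (mu b.2)%:A.
have Sev b : S b.1 (ev b).
  apply: subalgebra_center => //; elim: (b.2) => [|m IHm].
    by rewrite expr0; have [] := S_alg b.1; rewrite inE.
  by rewrite exprS; exact: subalgebra_mul.
have [r|] := boolP (reduced e (unzip1 w)).
  have [->|w0] := eqVneq w [::].
    by rewrite big_nil tau1 normr1 (le_trans C1).
  suff -> : tau A (\prod_(b <- w) ev b) = 0 by rewrite normr0 (le_trans C0).
  have := (proj2 S_ind) [seq (b.1, ev b) | b <- w].
  rewrite big_map /unzip1 -map_comp; apply=> //.
    by rewrite -size_eq0 size_map size_eq0.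
  move=> _ /mapP[b _ ->] /=; split; first exact: Sev.
  by rewrite linearB /= tau_scalar ymu subrr.
case/not_reduced=> P [[v m] [M [[v' m'] [Q [wE /= vv' aM]]]]].
have wD' := wD; rewrite wE all_cat /= all_cat /= in wD'.
have /and5P[PD mD MD mD' QD] := wD'; rewrite -vv' in wE.
rewrite -[\prod_(b <- w) _]/(\prod_(b <- w) ev b).
have -> : \prod_(b <- w) ev b =
  \prod_(b <- P) ev b * (ev (v, m) * ev (v, m')) * \prod_(b <- M ++ Q) ev b.
  rewrite wE; have := @prod_merge _ A V e S e_sym S_ind [seq (b.1, ev b) | b <- P]
    (v, ev (v, m)) [seq (b.1, ev b) | b <- M] (v, ev (v, m'))
    [seq (b.1, ev b) | b <- Q].
  rewrite !(big_cat, big_cons, big_map) /= => ->.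
  - by [].
  - by [].
  - by rewrite /unzip1 -map_comp; exact: aM.
  - by move=> x /mapP[b _ ->]; exact: Sev.
  - exact: (Sev (v, m')).
(* The product of two centered powers is a combination of centered powers and a scalar, so every
   resulting word is shorter by at least one letter. *)
have -> : ev (v, m) * ev (v, m') = ev (v, (m + m')%N) - mu m *: ev (v, m') -
    mu m' *: ev (v, m) + (mu (m + m')%N - mu m * mu m')%:A.
  rewrite /ev /= mulrBl !mulrBr -exprD -!scalerAr mulr1 -!scalerAl !mul1r.
  rewrite !scalerBr !scalerA scalerBl [mu m' * _]mulrC.
  exact: sub_cancel.
have bound t m1 : t = ev (v, m1) -> (m1 <= D + D)%N ->
  `|tau A (\prod_(b <- P) ev b * t * \prod_(b <- M ++ Q) ev b)| <= C.
  move=> -> m1D; have := hC A V e S y e_sym S_alg S_ind Sy ymu (P ++ (v, m1) :: M ++ Q).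
  rewrite big_cat big_cons /= mulrA; apply.
    by move: wN; rewrite wE !size_cat /= !size_cat /= !addnS !ltnS.
  have mono s : all (fun b : V * nat => b.2 <= D)%N s ->
      all (fun b => b.2 <= D + D)%N s.
    by apply: sub_all => b; move/leq_trans; apply; exact: leq_addr.
  by rewrite all_cat /= m1D all_cat !mono.
have bound0 : `|tau A (\prod_(b <- P) ev b * 1 * \prod_(b <- M ++ Q) ev b)| <= C.
  have := hC A V e S y e_sym S_alg S_ind Sy ymu (P ++ M ++ Q).
  rewrite mulr1 -big_cat; apply.
    by move: wN; rewrite wE !size_cat /= !size_cat /= !addnS !ltnS => /ltnW.
  have mono s : all (fun b : V * nat => b.2 <= D)%N s ->
      all (fun b => b.2 <= D + D)%N s.
    by apply: sub_all => b; move/leq_trans; apply; exact: leq_addr.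
  by rewrite all_cat /= all_cat !mono.
have mDD : (m <= D + D)%N by apply: leq_trans mD (leq_addr _ _).
have mDD' : (m' <= D + D)%N by apply: leq_trans mD' (leq_addr _ _).
set p := \prod_(b <- P) ev b in bound bound0 *.
set q := \prod_(b <- M ++ Q) ev b in bound bound0 *.
have fD z z' : tau A (p * (z + z') * q) = tau A (p * z * q) + tau A (p * z' * q).
  by rewrite mulrDr mulrDl linearD.
have fN z : tau A (p * - z * q) = - tau A (p * z * q).
  by rewrite mulrN mulNr linearN.
have fZ c z : tau A (p * (c *: z) * q) = c * tau A (p * z * q).
  by rewrite -scalerAr -scalerAl linearZ.
have b1 := bound _ (m + m')%N erefl (leq_add mD mD').
have b2 := bound _ m erefl mDD.
have b3 := bound _ m' erefl mDD'.
move: (ev _) (ev _) (ev _) b1 b2 b3 => z1 z2 z3 b1 b2 b3.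
rewrite !(fD, fN, fZ).
rewrite (mulrDr C _ (K + _)) (mulrDr C (1 + K)) (mulrDr C 1) mulr1.
have scaled c t K' : `|c| <= K' -> `|t| <= C -> `|c * t| <= C * K'.
  by move=> cK tC; rewrite normrM mulrC ler_pM.
apply: le_trans (ler_normD _ _) _; apply: lerD.
  apply: le_trans (ler_normD _ _) _; apply: lerD; rewrite ?normrN.
    apply: le_trans (ler_normD _ _) _; apply: lerD; rewrite ?normrN.
      exact: b1.
    by apply: scaled; [exact: muK | exact: b3].
  by apply: scaled; [exact: muK | exact: b2].
apply: scaled => //; apply: le_trans (ler_normB _ _) _; apply: lerD.
  by apply: muK; rewrite leq_add.
by rewrite normrM ler_pM ?muK.
Qed.

End MomentBound.

(** * Words labelled by subsets *)

Section SortedSubseq.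
Variables (X : eqType) (lt : rel X).
Hypotheses (lt_trans : transitive lt) (lt_irr : irreflexive lt).

(** A strictly sorted sequence is determined by its elements, so a sorted [t] is the filter of [s]
    by membership in [t]. *)
Lemma subseq_sortedE (s t : seq X) : sorted lt s ->
  subseq t s = sorted lt t && all (mem s) t.
Proof.
move=> ss; apply/idP/andP => [ts|[st /allP ts]].
  split; first exact: subseq_sorted ts ss.
  by apply/allP => x xt; exact: (mem_subseq ts).
have <- : [seq x <- s | x \in t] = t; last exact: filter_subseq.
apply: (irr_sorted_eq lt_trans lt_irr) => //; first exact: sorted_filter.
move=> x; rewrite mem_filter; apply/andP/idP => [[]//|xt].
by split=> //; exact: ts.
Qed.

End SortedSubseq.

Lemma subseq_mapE (X Y : eqType) (f : X -> Y) (s : seq Y) (t : seq X) :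
  subseq s (map f t) -> exists2 t', subseq t' t & map f t' = s.
Proof.
case/subseqP => m sm ->; exists (mask m t); first exact: mask_subseq.
by rewrite map_mask.
Qed.

Section LabelledWord.
Variables (p L : nat) (J : 'I_p -> nonempty_set L) (alpha : 'I_p -> bool).

(** The flag [a] records an adjoint, which reverses a product of self-adjoint letters. *)
Definition label_seq (a : bool) (I : {set 'I_L}) : seq 'I_L :=
  if a then rev (enum I) else enum I.

(* Occurrences of letters in the word whose r-th factor is the product over
   l in J r, in increasing order of l if alpha r = false and in decreasing
   order if alpha r = true. *)
Definition occurrences : seq ('I_p * 'I_L) :=
  flatten [seq [seq (r, l) | l <- label_seq (alpha r) (val (J r))] |
             r <- enum 'I_p].

(** The strict order along which [occurrences] is sorted. *)
Definition occ_lt : rel ('I_p * 'I_L) := fun x y =>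
  (x.1 < y.1)%N || (x.1 == y.1) &&
    (if alpha x.1 then (y.2 < x.2)%N else (x.2 < y.2)%N).

Lemma occ_lt_trans : transitive occ_lt.
Proof.
move=> [r l] [r1 l1] [r2 l2]; rewrite /occ_lt /=.
case/orP=> [r12|/andP[/eqP -> a1]] /orP[r2r|/andP[/eqP <- a2]].
- by rewrite (ltn_trans r12 r2r).
- by rewrite r12.
- by rewrite r2r.
- rewrite eqxx /=; move: a1 a2; case: (alpha r) => a1 a2; apply/orP; right.
    exact: ltn_trans a2 a1.
  exact: ltn_trans a1 a2.
Qed.

Lemma occ_lt_irr : irreflexive occ_lt.
Proof. by move=> [r l]; rewrite /occ_lt /= !ltnn eqxx /=; case: ifP. Qed.

Lemma mem_label_seq a (I : {set 'I_L}) l : (l \in label_seq a I) = (l \in I).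
Proof. by case: a; rewrite /label_seq ?mem_rev mem_enum. Qed.

Lemma uniq_label_seq a (I : {set 'I_L}) : uniq (label_seq a I).
Proof. by case: a; rewrite /label_seq ?rev_uniq enum_uniq. Qed.

Lemma mem_occurrences r l : ((r, l) \in occurrences) = (l \in val (J r)).
Proof.
apply/flatten_mapP/idP => [[r' _ /mapP[l' ll' [-> ->]]]|lJ].
  by rewrite mem_label_seq in ll'.
exists r; rewrite ?mem_enum //; apply/mapP; exists l => //.
by rewrite mem_label_seq.
Qed.

Lemma ord_enum_sorted m : sorted (fun i j : 'I_m => (i < j)%N) (enum 'I_m).
Proof.
have := iota_ltn_sorted 0 m; rewrite -val_enum_ord.
by rewrite sorted_map.
Qed.

Lemma sorted_occurrences : sorted occ_lt occurrences.
Proof.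
have pairwise_block r :
    pairwise occ_lt [seq (r, l) | l <- label_seq (alpha r) (val (J r))].
  rewrite pairwise_map.
  have sE : sorted (fun i j : 'I_L => (i < j)%N) (enum (val (J r))).
    rewrite /enum_mem; apply: sorted_filter => [? ? ?|]; first exact: ltn_trans.
    by rewrite -enumT; exact: ord_enum_sorted.
  apply: sub_pairwise (_ : pairwise (fun i j : 'I_L =>
    if alpha r then (j < i)%N else (i < j)%N) _) => [i j|].
    by rewrite /occ_lt /= eqxx => ->; rewrite orbT.
  rewrite -sorted_pairwise; last first.
    by move=> i j k; case: (alpha r) => ij jk; [exact: ltn_trans jk ij|exact: ltn_trans ij jk].
  rewrite /label_seq; case: (alpha r) => //.
  by rewrite rev_sorted.
rewrite sorted_pairwise; last exact: occ_lt_trans.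
rewrite /occurrences; have : pairwise (fun i j : 'I_p => (i < j)%N) (enum 'I_p).
  rewrite -sorted_pairwise; first exact: ord_enum_sorted.
  by move=> i j k; exact: ltn_trans.
elim: (enum 'I_p) => [//|r s IH] /= /andP[rs /IH ps].
rewrite pairwise_cat pairwise_block ps !andbT; apply/allrelP => x y.
case/mapP=> l _ -> /flatten_mapP[r' r's /mapP[l' _ ->]].
by rewrite /occ_lt /= (allP rs).
Qed.

Variable n : nat.

(** The word that the choice [k] of summation indices contributes to the p-th moment. *)
Definition labelled_word (k : 'I_p -> 'I_n) : seq ('I_n * 'I_L) :=
  [seq (k x.1, x.2) | x <- occurrences].

Lemma count_labelled_word k c l : count_mem (c, l) (labelled_word k) =
  #|[set r | (k r == c) && (l \in val (J r))]|%SET.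
Proof.
rewrite count_map count_flatten -map_comp sumnE big_map big_enum /=.
rewrite -sum1_card (eq_bigr (fun r => nat_of_bool ((k r == c) && (l \in val (J r))))).
  by rewrite -big_mkcond /=; apply: eq_bigl => r; rewrite inE.
move=> r _; rewrite count_map.
under eq_count => l' do rewrite /= xpair_eqE.
have [_|_] := eqVneq (k r) c; rewrite /= ?count_pred0 //.
by rewrite -(mem_label_seq (alpha r)) -count_uniq_mem // uniq_label_seq.
Qed.

Lemma size_labelled_word k : size (labelled_word k) = (\sum_(r < p) #|val (J r)|)%N.
Proof.
rewrite size_map size_flatten /shape -map_comp sumnE big_map big_enum /=.
by apply: eq_bigr => r _; rewrite size_map /label_seq cardE; case: ifP; rewrite ?size_rev.
Qed.

(** The word is the image of a sorted list of positions, so a pattern u v u v lifts to a chain of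
    four positions. *)
Lemma crossings_labelled_word (e : rel ('I_n * 'I_L)) k :
  crossings_adjacent e (labelled_word k) <->
  forall r1 r2 r3 r4 l l',
    path occ_lt (r1, l) [:: (r2, l'); (r3, l); (r4, l')] ->
    l \in val (J r1) -> l \in val (J r3) ->
    l' \in val (J r2) -> l' \in val (J r4) ->
    k r1 = k r3 -> k r2 = k r4 -> e (k r1, l) (k r2, l').
Proof.
split=> h.
  move=> r1 r2 r3 r4 l l' lt14 l1 l3 l2 l4 k13 k24; apply: h.
  have -> : [:: (k r1, l); (k r2, l'); (k r1, l); (k r2, l')] =
      [seq (k x.1, x.2) | x <- [:: (r1, l); (r2, l'); (r3, l); (r4, l')]].
    by rewrite /= k13 k24.
  apply: map_subseq; rewrite (subseq_sortedE occ_lt_trans occ_lt_irr _ sorted_occurrences).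
  by rewrite [sorted _ _]lt14 /= !mem_occurrences l1 l2 l3 l4.
move=> u v /subseq_mapE[t].
rewrite (subseq_sortedE occ_lt_trans occ_lt_irr _ sorted_occurrences).
case: t => [|[r1 l1] [|[r2 l2] [|[r3 l3] [|[r4 l4] [|? ?]]]]] //.
rewrite [sorted _ _]/= => /andP[lt14 /=].
rewrite !mem_occurrences andbT => /and4P[m1 m2 m3 m4] [<- <- [k31 l31] [k42 l42]].
rewrite l31 l42 in m3 m4 lt14.
by apply: (h r1 r2 r3 r4 l1 l2 lt14).
Qed.

End LabelledWord.

(** * Index choices whose kernel is a pair partition *)

Section PairKernel.
Variables (p L n : nat) (J : 'I_p -> nonempty_set L) (alpha : 'I_p -> bool).
Variables (gL : sgraph 'I_L) (g : sgraph 'I_n).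

Definition constant_on (k : 'I_p -> 'I_n) (pi : {set {set 'I_p}}) : bool :=
  [forall u in pi, forall r in u, forall s in u, k r == k s].

Lemma constant_onP k (pi : {set {set 'I_p}}) : reflect
  (forall u r s, u \in pi -> r \in u -> s \in u -> k r = k s)
  (constant_on k pi).
Proof.
apply: (iffP forall_inP) => h u.
  by move=> r s /h /forall_inP hu /hu /forall_inP hr /hr /eqP.
move=> upi; apply/forall_inP => r ru; apply/forall_inP => s su.
by apply/eqP; exact: h upi ru su.
Qed.

Lemma block_labelE (pi : {set {set 'I_p}}) (u : {set 'I_p}) r :
  label_compatible J pi -> u \in pi -> r \in u ->
  block_label J u = val (J r).
Proof.
move=> /forall_inP lc upi ru; rewrite /block_label.
case: pickP => [s su|/(_ r)]; last by rewrite ru.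
by have /forall_inP/(_ _ su)/forall_inP/(_ _ ru)/eqP -> := lc u upi.
Qed.

(** The condition that [g] imposes on [k]: it concerns crossing blocks with a common label, since
    letters with distinct labels are compared by [gL]. *)
Definition meeting_edges (k : 'I_p -> 'I_n) (pi : {set {set 'I_p}}) : bool :=
  [forall u in pi, forall v in pi,
     crossing u v && (block_label J u :&: block_label J v != finset.set0) ==>
     [forall r in u, forall s in v, g (k r) (k s)]].

Variable k : 'I_p -> 'I_n.
Let fiber r := [set s | k s == k r]%SET.
Variable pi : {set {set 'I_p}}.
Hypothesis fiber2 : forall r, #|fiber r| = 2%N.
Hypothesis pi_pair : pair_partition pi.
Hypothesis pi_const : constant_on k pi.

(** A block lies in a fiber because [k] is constant on it, and both have two elements; [pi] is
    therefore the kernel of [k]. *)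
Lemma block_fiber u r : u \in pi -> r \in u -> u = fiber r.
Proof.
move=> upi ru; apply/eqP; rewrite eqEcard fiber2; apply/andP; split.
  by apply/fintype.subsetP => s su; rewrite inE (constant_onP _ _ pi_const u s r).
by have /andP[_ /forall_inP /(_ u upi) /eqP ->] := pi_pair.
Qed.

Lemma fiber_block r : fiber r \in pi.
Proof.
have /andP[/and3P[/eqP cp _ _] _] := pi_pair.
have : r \in finset.cover pi by rewrite cp inE.
by case/finset.bigcupP => u upi ru; rewrite -(block_fiber upi ru).
Qed.

Lemma block_nonempty u : u \in pi -> exists r, r \in u.
Proof.
move=> upi; apply/finset.set0Pn; rewrite -card_gt0.
by have /andP[_ /forall_inP/(_ u upi)/eqP ->] := pi_pair.
Qed.

Lemma mem_fiber r : r \in fiber r.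
Proof. by rewrite inE. Qed.

Lemma interlaceP (u v : {set 'I_p}) : reflect
  (exists a b c d, [/\ a \in u, b \in v, c \in u, d \in v &
     (a < b < c)%N && (c < d)%N]) (interlace u v).
Proof.
apply: (iffP exists_inP) => [[a au /exists_inP[b bv /exists_inP[c cu]]]|].
  by case/exists_inP=> d dv abcd; exists a, b, c, d.
case=> a [b [c [d [au bv cu dv abcd]]]].
exists a => //; apply/exists_inP; exists b => //.
by apply/exists_inP; exists c => //; apply/exists_inP; exists d.
Qed.

Local Notation e := (nested_adjacent gL g).

Let e_sym : symmetric e.
Proof. by apply: nested_adjacent_sym; exact: adjacent_sym. Qed.

(** Crossing letters with equal labels give [meeting_edges]; those with distinct labels give the
    conditions on [gL]. Letters with different indices cross when their blocks cross. Two letters of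
    one block cross exactly when both factors list the labels in the same order, that is, when their
    exponents agree. *)
Lemma admissible_crossings :
  label_compatible J pi && `[< crossings_adjacent e (labelled_word J alpha k) >] =
  admissible_partition J gL alpha pi && meeting_edges k pi.
Proof.
rewrite /admissible_partition pi_pair /=.
have [lc|//] /= := boolP (label_compatible J pi).
have Jk r s : k r = k s -> J r = J s.
  move=> krs; have /forall_inP/(_ _ (fiber_block r)) := lc.
  move=> /forall_inP/(_ r (mem_fiber r)) /forall_inP/(_ s) h.
  by apply/eqP; apply: h; rewrite inE krs.
apply/idP/idP => [/asboolP/crossings_labelled_word ca|].
  have inter u v : interlace u v -> u \in pi -> v \in pi ->
      forall r s l l', r \in u -> s \in v -> l \in block_label J u ->
      l' \in block_label J v -> e (k r, l) (k s, l').
    move=> /interlaceP[a [b [c [d [au bv cu dv /andP[/andP[ab bc] cd]]]]]] upi vpi.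
    move=> r s l l' ru sv; rewrite (block_labelE lc upi au) (block_labelE lc vpi bv).
    move=> la lb; have kac := constant_onP _ _ pi_const u _ _ upi au cu.
    have kbd := constant_onP _ _ pi_const v _ _ vpi bv dv.
    rewrite (constant_onP _ _ pi_const u r a) // (constant_onP _ _ pi_const v s b) //.
    apply: (ca a b c d); rewrite ?(Jk _ _ kac) ?(Jk _ _ kbd) -?(Jk _ _ kac) -?(Jk _ _ kbd) //.
    by rewrite /= /occ_lt /= ab bc cd.
  have cross u v : crossing u v -> u \in pi -> v \in pi ->
      forall r s l l', r \in u -> s \in v -> l \in block_label J u ->
      l' \in block_label J v -> e (k r, l) (k s, l').
    case/orP=> uv upi vpi r s l l' ru sv lu lv; first exact: inter uv _ _ _ _ _ _ _ _ _ _.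
    by rewrite e_sym; exact: inter uv _ _ _ _ _ _ _ _ _ _.
  apply/andP; split; last first.
    apply/forall_inP => u upi; apply/forall_inP => v vpi.
    apply/implyP => /andP[uv /finset.set0Pn[l]]; rewrite inE => /andP[lu lv].
    apply/forall_inP => r ru; apply/forall_inP => s sv.
    by have := cross u v uv upi vpi r s l l ru sv lu lv; rewrite /nested_adjacent /= eqxx.
  apply/andP; split.
    apply/forallP => u; apply/forallP => v; apply/implyP => uv.
    apply/forall_inP => l lu; apply/forall_inP => l' lv; apply/implyP => ll'.
    have [r ru] := block_nonempty (valP u).
    have [s sv] := block_nonempty (valP v).
    have := cross _ _ uv (valP u) (valP v) r s l l' ru sv lu lv.
    by rewrite /nested_adjacent /= (negPf ll').
  apply/forall_inP => u upi; apply/forall_inP => r ru; apply/forall_inP => s su.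
  apply/implyP => /andP[rs /eqP ars].
  have krs := constant_onP _ _ pi_const u _ _ upi ru su.
  rewrite (block_labelE lc upi ru).
  apply/forall_inP => l1 h1; apply/forall_inP => l2 h2; apply/implyP => l12.
  (* With equal exponents, two distinct labels of a block form a crossing pattern starting with one
     of them; symmetry of [gL] covers both cases. *)
  have key x y l l' : k x = k y -> alpha x = alpha y -> (x < y)%N ->
      l \in val (J x) -> l' \in val (J x) -> l != l' -> gL l l'.
    move=> kxy axy xy; wlog lx : l l' / occ_lt alpha (x, l) (x, l').
      move=> W lJ l'J ll'.
      have [h|h] : occ_lt alpha (x, l) (x, l') \/ occ_lt alpha (x, l') (x, l).
        rewrite /occ_lt /= eqxx ltnn /=; move: ll'; rewrite -val_eqE neq_ltn.
        by case: (alpha x) => /orP[]; [right|left|left|right].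
      - exact: W.
      - by rewrite adjacent_sym; apply: W; rewrite // eq_sym.
    move=> lJ l'J ll'; have := ca x x y y l l'.
    rewrite /nested_adjacent /= (negPf ll'); apply=> //; rewrite -?(Jk _ _ kxy) //.
    rewrite lx {1}/occ_lt /= xy /= andbT; move: lx.
    by rewrite /occ_lt /= !ltnn !eqxx axy.
  have [rs'|sr|rs'] := ltngtP r s.
  - exact: (key r s).
  - by apply: (key s r); rewrite // -(Jk _ _ krs).
  - by rewrite (val_inj rs') eqxx in rs.
case/andP=> /andP[/forallP adm /forall_inP circ] /forall_inP meet.
apply/asboolP/crossings_labelled_word => r1 r2 r3 r4 l l' ch l1 l3 l2 l4 k13 k24.
have le_occ (x y : 'I_p * 'I_L) : occ_lt alpha x y -> (x.1 <= y.1)%N.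
  by case/orP=> [/ltnW|/andP[/eqP ->]].
have strict r s (x : 'I_L) : occ_lt alpha (r, x) (s, x) -> (r < s)%N.
  by case/orP=> [//|/andP[/= /eqP <-]]; case: ifP; rewrite ltnn.
move: ch => /= /and4P[h12 h23 h34 _].
have r13 : (r1 < r3)%N by apply: (strict r1 r3 l); exact: occ_lt_trans h12 h23.
have r24 : (r2 < r4)%N by apply: (strict r2 r4 l'); exact: occ_lt_trans h23 h34.
have := le_occ _ _ h12; have := le_occ _ _ h23; have := le_occ _ _ h34 => /= r34 r23 r12.
(* If the two letters share their index, all four positions lie in a fiber of two elements, which
   forces [r1 = r2] and [r3 = r4]. Otherwise the four positions are strictly increasing and two
   blocks cross. *)
have [k12|nk12] := eqVneq (k r1) (k r2).
  have fE : fiber r1 = [set r1; r3]%SET.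
    apply/esym/eqP; rewrite eqEcard fiber2 cards2 -val_eqE /= (ltn_eqF r13) andbT.
    by apply/fintype.subsetP => x; rewrite !inE => /orP[]/eqP ->; rewrite ?eqxx ?k13.
  have : r2 \in fiber r1 by rewrite inE k12.
  have : r4 \in fiber r1 by rewrite inE k12 k24.
  rewrite fE !inE => /orP[]/eqP r4E /orP[]/eqP r2E; rewrite r4E r2E in r24.
  - by rewrite ltnn in r24.
  - by have := ltn_trans r13 r24; rewrite ltnn.
  - move: h12 h34; rewrite r2E r4E /occ_lt /= !ltnn !eqxx /= => h12 h34.
    have ll' : l != l' by apply: contraTneq h12 => ->; case: ifP; rewrite ltnn.
    rewrite /nested_adjacent /= (negPf ll').
    have : (r1 != r3) && (alpha r1 == alpha r3).
      rewrite -val_eqE (ltn_eqF r13) /=; move: h12 h34.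
      by case: (alpha r1); case: (alpha r3) => // h1 h2;
        have := ltn_trans h1 h2; rewrite ltnn.
    have /forall_inP/(_ r1 (mem_fiber r1)) := circ _ (fiber_block r1).
    move=> /forall_inP/(_ r3); rewrite inE k13 eqxx => /(_ isT) /implyP h /h.
    rewrite (block_labelE lc (fiber_block r1) (mem_fiber r1)).
    move=> /forall_inP/(_ l l1) /forall_inP/(_ l').
    by rewrite (Jk _ _ k12) => /(_ l2) /implyP; apply.
  - by rewrite ltnn in r24.
have r12' : (r1 < r2)%N.
  by rewrite ltn_neqAle r12 andbT; apply: contraNneq nk12 => /val_inj ->.
have r23' : (r2 < r3)%N.
  by rewrite ltn_neqAle r23 andbT; apply: contraNneq nk12 => /val_inj ->; rewrite k13.
have r34' : (r3 < r4)%N.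
  rewrite ltn_neqAle r34 andbT; apply: contraNneq nk12 => /val_inj r34e.
  by rewrite k13 k24 r34e.
have cr : crossing (fiber r1) (fiber r2).
  apply/orP; left; apply/interlaceP; exists r1, r2, r3, r4.
  by split; rewrite ?inE ?k13 ?k24 ?eqxx ?r12' ?r23' ?r34'.
have lr := block_labelE lc (fiber_block _) (mem_fiber _).
have [ll'|nll'] := eqVneq l l'.
  rewrite /nested_adjacent /= ll' eqxx.
  have /forall_inP/(_ _ (fiber_block r2)) := meet _ (fiber_block r1).
  rewrite cr !lr => /implyP h.
  have /h : true && (val (J r1) :&: val (J r2) != finset.set0).
    by apply/finset.set0Pn; exists l; rewrite inE l1 ll' l2.
  move=> /forall_inP/(_ r1 (mem_fiber r1)) /forall_inP; apply; exact: mem_fiber.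
rewrite /nested_adjacent /= (negPf nll').
pose blk r : block pi := exist _ (fiber r) (fiber_block r).
have /forallP/(_ (blk r2)) := adm (blk r1).
rewrite /intersection_graph /= cr !lr /= => /forall_inP/(_ l l1).
by move=> /forall_inP/(_ l' l2) /implyP; apply.
Qed.

End PairKernel.

(** * Limits of moments *)

Section MomentExpansion.
Variables (F : fieldType) (p L n : nat) (J : 'I_p -> nonempty_set L).
Variables (alpha : 'I_p -> bool) (gL : sgraph 'I_L) (g : sgraph 'I_n).
Variables (m : seq ('I_n * 'I_L) -> F) (s : F).
Hypothesis m_single : forall v w, count_mem v w = 1%N -> m w = 0.
Hypothesis m_pairs : forall w, (forall v, v \in w -> count_mem v w = 2%N) ->
  m w = if `[< crossings_adjacent (nested_adjacent gL g) w >] then s ^+ size w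
        else 0.

(** Choices with fewer than p/2 values; they are negligible at the scale n^(-p/2). *)
Definition small_image (k : 'I_p -> 'I_n) : bool :=
  (#|finset.imset k (mem [set: 'I_p]%SET)|.*2 < p)%N.

Definition total_label : nat := (\sum_(r < p) #|val (J r)|)%N.

(** If some value of [k] is taken once, a letter occurs once and [k] is constant on the blocks of no
    pair partition, so both sides vanish. Otherwise every value is taken twice, the kernel of [k] is
    the only pair partition in the sum, and [admissible_crossings] compares the two sides. *)
Lemma moment_pair_sum (k : 'I_p -> 'I_n) : ~~ small_image k ->
  m (labelled_word J alpha k) =
  \sum_(pi : {set {set 'I_p}} |
      admissible_partition J gL alpha pi && constant_on k pi)
    s ^+ total_label * (meeting_edges J g k pi)%:R.
Proof.
rewrite /small_image -leqNgt => big_im.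
pose fiber r := [set s | k s == k r]%SET.
have fiber_gt0 r : (0 < #|fiber r|)%N.
  by rewrite card_gt0; apply/finset.set0Pn; exists r; rewrite inE.
have inJ r : exists l, l \in val (J r) by apply/finset.set0Pn; exact: (valP (J r)).
have [/existsP[r /eqP r1]|/existsPn nf1] := boolP [exists r, #|fiber r| == 1%N].
  rewrite big1 => [|pi /andP[
    /and4P[/andP[/and3P[/eqP cp _ _] /forall_inP p2] _ _ _] /constant_onP pc]].
    have [l lJ] := inJ r; apply: (@m_single (k r, l)).
    rewrite count_labelled_word; apply/eqP; rewrite eqn_leq -{1}r1; apply/andP; split.
      by apply: subset_leq_card; apply/fintype.subsetP => x; rewrite !inE => /andP[].
    by rewrite card_gt0; apply/finset.set0Pn; exists r; rewrite inE eqxx.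
  have : r \in finset.cover pi by rewrite cp inE.
  case/finset.bigcupP => u upi ru; have /eqP u2 := p2 u upi.
  suff : (#|u| <= #|fiber r|)%N by rewrite u2 r1.
  by apply: subset_leq_card; apply/fintype.subsetP => x xu; rewrite inE (pc u x r).
(* At least p/2 values are taken, each at least twice, so p positions leave exactly two for each. *)
have fiber2 r : #|fiber r| = 2%N.
  pose f (c : 'I_n) := #|[set x | k x == c]|%SET.
  have sumf : (\sum_(c in finset.imset k (mem [set: 'I_p]%SET)) f c = p)%N.
    rewrite -[RHS](card_ord p) -cardsT -sum1_card (partition_big_imset k) /=.
    by apply: eq_bigr => c _; rewrite /f -sum1_card; apply: eq_bigl => x; rewrite !inE.
  have f2 c : c \in finset.imset k (mem [set: 'I_p]%SET) -> (2 <= f c)%N.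
    case/imsetP => x _ ->; have := nf1 x; have := fiber_gt0 x.
    by rewrite -/(f (k x)); case: (f (k x)) => [|[|]].
  have rim : k r \in finset.imset k (mem [set: 'I_p]%SET) by apply: imset_f; rewrite inE.
  apply/eqP; rewrite eqn_leq [(1 < _)%N](f2 _ rim) andbT.
  move: sumf big_im; rewrite (bigD1 (k r)) //= (cardD1 (k r)) rim /= -/(f (k r)).
  have : (#|[predD1 finset.imset k (mem [set: 'I_p]%SET) & k r]|.*2 <=
    \sum_(c in finset.imset k (mem [set: 'I_p]%SET) | c != k r) f c)%N.
    rewrite -muln2 -sum_nat_const.
    rewrite (eq_bigl (fun c => (c \in finset.imset k (mem [set: 'I_p]%SET)) && (c != k r))) => [|c].
      by apply: leq_sum => c /andP[/f2].
    by rewrite !inE andbC.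
  by move: #|_| (\sum_(_ in _ | _) _)%N (f (k r)) => a b c; lia.
pose pi0 := finset.imset fiber (mem [set: 'I_p]%SET).
have pi0_pair : pair_partition pi0.
  apply/andP; split; last by apply/forall_inP => u /imsetP[r _ ->]; rewrite fiber2.
  apply/and3P; split.
  - apply/eqP/setP => r; rewrite inE; apply/finset.bigcupP; exists (fiber r).
      by apply: imset_f; rewrite inE.
    by rewrite inE.
  - apply/finset.trivIsetP => _ _ /imsetP[r _ ->] /imsetP[t _ ->] nrt.
    rewrite -setI_eq0; apply: contraNT nrt => /finset.set0Pn[x].
    by rewrite !inE => /andP[/eqP h1 /eqP h2]; apply/eqP/setP => y; rewrite !inE -h1 h2.
  - apply/imsetP => -[r _ h]; have := fiber2 r; rewrite -h cards0.
    by [].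
have pi0_const : constant_on k pi0.
  apply/constant_onP => u r t /imsetP[x _ ->]; rewrite !inE.
  by move=> /eqP -> /eqP ->.
have pi_uniq pi : pair_partition pi -> constant_on k pi -> pi = pi0.
  move=> pp pc; apply/setP => u; apply/idP/imsetP => [upi|[r _ ->]].
    have [r ru] := block_nonempty pp upi.
    by exists r; rewrite ?inE //; exact: (block_fiber fiber2 pp pc upi ru).
  exact: fiber_block fiber2 pp pc r.
have key := admissible_crossings J alpha gL g fiber2 pi0_pair pi0_const.
transitivity (if admissible_partition J gL alpha pi0 && meeting_edges J g k pi0
  then s ^+ total_label else 0); last first.
  have [adm|nadm] := boolP (admissible_partition J gL alpha pi0).
    rewrite (big_pred1 pi0) => [|pi] /=.
      by case: meeting_edges; rewrite ?mulr1 ?mulr0.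
    apply/andP/eqP => [[/and4P[pp _ _ _] pc]|->]; first exact: pi_uniq.
    by split.
  rewrite big_pred0 // => pi; apply/negP => /andP[ad pc].
  have pp : pair_partition pi by case/and4P: ad.
  by move: nadm; rewrite -(pi_uniq pi pp pc) ad.
rewrite -key; have [lc|nlc] /= := boolP (label_compatible J pi0).
  rewrite m_pairs ?size_labelled_word // => -[c l] /mapP[[r l'] + [-> ->]] /=.
  rewrite mem_occurrences => lr; rewrite count_labelled_word -(fiber2 r).
  apply: eq_card => x; rewrite !inE andbC; case: eqP => kx; rewrite ?andbF // andbT.
  move/forall_inP: lc => /(_ (fiber r)) lc.
  have /lc/forall_inP/(_ r) : fiber r \in pi0 by apply: imset_f; rewrite inE.
  rewrite inE eqxx => /(_ isT) /forall_inP/(_ x); rewrite inE kx eqxx.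
  by move=> /(_ isT)/eqP <-.
have [u [r [t [upi ru tu nJ]]]] : exists u r t,
    [/\ u \in pi0, r \in u, t \in u & J r != J t].
  move: nlc; rewrite negb_forall_in => /exists_inP[u upi].
  rewrite negb_forall_in => /exists_inP[r ru]; rewrite negb_forall_in.
  by move=> /exists_inP[t tu nJ]; exists u, r, t.
(* If the label sets of a block differ, a label in only one of them gives a letter that occurs
   exactly once. *)
wlog [l lr lt] : r t ru tu nJ / exists2 l, l \in val (J r) & l \notin val (J t).
  move=> W; have [sub|/fintype.subsetPn nsub] := boolP (val (J r) \subset val (J t)).
    have /fintype.subsetPn nsub : ~~ (val (J t) \subset val (J r)).
      apply: contra nJ => sub'; rewrite -val_eqE finset.eqEsubset.
      by rewrite sub.
    by apply: (W t r) => //; rewrite eq_sym.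
  exact: (W r t).
have urt : u = [set r; t]%SET.
  apply/esym/eqP; rewrite eqEcard cards2.
  have -> : r != t by apply: contraNneq nJ => ->.
  have /andP[_ /forall_inP/(_ u upi)/eqP ->] := pi0_pair.
  by rewrite andbT; apply/fintype.subsetP => x; rewrite !inE => /orP[]/eqP ->.
apply: (@m_single (k r, l)); rewrite count_labelled_word.
rewrite -(cards1 r); apply: eq_card => x; rewrite !inE.
have uE := block_fiber fiber2 pi0_pair pi0_const upi ru.
have -> : (k x == k r) = (x \in u) by rewrite uE inE.
rewrite urt !inE; have [->|_] := eqVneq x r; first by rewrite lr.
by have [->|_] := eqVneq x t; rewrite //= (negPf lt).
Qed.

End MomentExpansion.

(** * From pair partitions to homomorphism densities *)

Section MeetingGraph.
Variables (p L : nat) (J : 'I_p -> nonempty_set L) (pi : {set {set 'I_p}}).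

(** Crossings between blocks with disjoint labels are left out, because [graphon_star] is 1 there;
    [u != v] makes the graph loopless for any [pi]. *)
Definition meeting_rel : rel (block pi) := fun u v =>
  [&& u != v, crossing (val u) (val v) &
      block_label J (val u) :&: block_label J (val v) != finset.set0].

Lemma meeting_rel_sym : symmetric meeting_rel.
Proof.
by move=> u v; rewrite /meeting_rel eq_sym /crossing orbC finset.setIC.
Qed.

Lemma meeting_rel_irr : irreflexive meeting_rel.
Proof. by move=> u; rewrite /meeting_rel eqxx. Qed.

Definition meeting_graph : sgraph (block pi) :=
  SGraph meeting_rel_sym meeting_rel_irr.

(** Omitted edges contribute the factor 1, so the integral is an ordinary graphon density, to which
    graphon convergence applies. *)
Lemma partition_integralE (R : realType) (w : graphon R) :
  partition_integral w J pi = graphon_density meeting_graph w.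
Proof.
rewrite /partition_integral /graphon_density /edge_integral.
congr (Rintegral _ _ _); apply/funext => x.
rewrite [LHS](bigID (fun uv : block pi * block pi =>
  block_label J (val uv.1) :&: block_label J (val uv.2) != finset.set0)) /=.
rewrite [X in _ * X]big1 ?mulr1 => [|uv /andP[_ /negPf nm]]; last first.
  by rewrite /graphon_star nm.
apply: eq_big => [[u v]|[u v] /andP[_ m]]; last by rewrite /graphon_star m.
rewrite /edge_of /= /meeting_rel /intersection_graph.
have [->|_] := eqVneq u v; first by rewrite ltnn.
by rewrite /= andbA.
Qed.

Hypothesis pi_pair : pair_partition pi.

(** A block interlaced with itself would have three elements. *)
Lemma crossing_irr u : u \in pi -> crossing u u = false.
Proof.
move=> upi; rewrite /crossing orbb.
case: (boolP (interlace u u)) => // h.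
have [a [b [c [d [au bu cu _ /andP[/andP[ab bc] _]]]]]] := interlaceP _ _ h.
have /andP[_ /forall_inP/(_ u upi)/eqP u2] := pi_pair.
have : (#|[set a; b; c]%SET| <= #|u|)%N.
  apply: subset_leq_card; apply/fintype.subsetP => x; rewrite !inE.
  by case/orP=> [/orP[]|] /eqP ->.
rewrite u2 -finset.setUA cardsU1 cards2 !inE -!val_eqE /=.
by rewrite (ltn_eqF ab) (ltn_eqF bc) (ltn_eqF (ltn_trans ab bc)).
Qed.

Lemma card_block : (#|{: block pi}|.*2 = p)%N.
Proof.
have /andP[part /forall_inP p2] := pi_pair.
have u2 u : u \in pi -> #|u| = 2%N by move/p2/eqP.
have := card_uniform_partition u2 part; rewrite cardsT card_ord => pE.
by rewrite card_sig -muln2 -pE.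
Qed.

Lemma block_ofP r : exists u : block pi, r \in val u.
Proof.
have /andP[/and3P[/eqP cp _ _] _] := pi_pair.
have : r \in finset.cover pi by rewrite cp inE.
by case/finset.bigcupP => u upi ru; exists (exist _ u upi).
Qed.

Lemma block_eq (u v : block pi) r : r \in val u -> r \in val v -> u = v.
Proof.
have /andP[/and3P[_ /finset.trivIsetP tI _] _] := pi_pair.
move=> ru rv; apply/val_inj/eqP; apply: contraT => nuv.
have := tI _ _ (valP u) (valP v) nuv; rewrite -setI_eq0 => /eqP/setP/(_ r).
by rewrite !inE ru rv.
Qed.

Lemma prod_nat_of_bool (R : comNzRingType) (T : finType) (P b : pred T) :
  \prod_(t | P t) (b t)%:R = [forall t, P t ==> b t]%:R :> R.
Proof.
have [/forallP h|/forallPn[t]] := boolP [forall t, P t ==> b t].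
  by rewrite big1 // => t Pt; have := h t; rewrite Pt /= => ->.
by rewrite negb_imply => /andP[Pt /negPf bt]; rewrite (bigD1 t) //= bt mul0r.
Qed.

(** A map constant on the blocks is a map on the set of blocks, and [meeting_edges] says that the
    latter is a homomorphism from the meeting graph to [g]. *)
Lemma sum_constant_on (R : comNzRingType) (n : nat) (g : sgraph 'I_n) :
  \sum_(k : {ffun 'I_p -> 'I_n} | constant_on k pi) (meeting_edges J g k pi)%:R
  = \sum_(phi : {ffun block pi -> 'I_n})
      \prod_(uv | edge_of meeting_graph uv) (g (phi uv.1) (phi uv.2))%:R :> R.
Proof.
pose blk r := xchoose (block_ofP r).
have blkP r : r \in val (blk r) by exact: xchooseP (block_ofP r).
have rep (u : block pi) : exists r, r \in val u.
  by have := block_nonempty pi_pair (valP u).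
pose rp u := xchoose (rep u).
have rpP u : rp u \in val u by exact: xchooseP (rep u).
pose h (phi : {ffun block pi -> 'I_n}) : {ffun 'I_p -> 'I_n} :=
  [ffun r => phi (blk r)].
pose h' (k : {ffun 'I_p -> 'I_n}) : {ffun block pi -> 'I_n} := [ffun u => k (rp u)].
rewrite (reindex_onto h h') => [|k /constant_onP kc]; last first.
  apply/ffunP => r; rewrite !ffunE.
  exact: kc (valP (blk r)) (rpP _) (blkP r).
apply: eq_big => [phi|phi _].
  have -> : h' (h phi) = phi.
    apply/ffunP => u; rewrite !ffunE; congr (phi _).
    exact: block_eq (blkP _) (rpP u).
  rewrite eqxx andbT; apply/constant_onP => u r s upi ru su; rewrite !ffunE.
  congr (phi _); apply: (block_eq (r := r)) => //.
  by rewrite -(block_eq (u := exist _ u upi) su (blkP s)).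
rewrite (prod_nat_of_bool _ _ (fun uv : block pi * block pi => g (phi uv.1) (phi uv.2))).
congr (_%:R); congr nat_of_bool.
have hE r (u : block pi) : r \in val u -> h phi r = phi u.
  by move=> ru; rewrite ffunE (block_eq (blkP r) ru).
apply/forall_inP/forallP => /= [me [u v]|me u upi].
  apply/implyP => /andP[/= _ /and3P[_ uv m]].
  have /forall_inP/(_ _ (valP v)) := me _ (valP u); rewrite uv m /=.
  move=> /forall_inP/(_ _ (rpP u))/forall_inP/(_ _ (rpP v)).
  by rewrite !(hE _ _ (rpP _)).
apply/forall_inP => v vpi; apply/implyP => /andP[uv m].
apply/forall_inP => r ru; apply/forall_inP => s sv.
pose u' : block pi := exist _ u upi; pose v' : block pi := exist _ v vpi.
rewrite (hE r u' ru) (hE s v' sv).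
have nuv : u' != v'.
  apply: contraTneq uv => /(congr1 val) /= <-; by rewrite crossing_irr.
have uvm : meeting_rel u' v' by rewrite /meeting_rel nuv /= uv m.
(* [edge_of] keeps one orientation of each edge; the other follows by symmetry of [g]. *)
have := nuv; rewrite -(inj_eq enum_rank_inj) -val_eqE neq_ltn => /orP[lt|lt].
  by have := me (u', v'); rewrite /edge_of /= lt uvm.
have := me (v', u'); rewrite /edge_of /= lt meeting_rel_sym uvm /=.
by rewrite adjacent_sym.
Qed.

End MeetingGraph.

Section SmallImages.

(** For p > 0, [p.-1./2] is the largest integer below p/2, so such a map factors through a set of
    that size. *)
Lemma card_small_image (p n : nat) :
  (#|[set k : {ffun 'I_p -> 'I_n} | small_image k]%SET| <=
   n ^ p.-1./2 * p.-1./2 ^ p)%N.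
Proof.
set d := p.-1./2.
have smallE (k : {ffun 'I_p -> 'I_n}) : small_image k ->
    (0 < p)%N && (#|finset.imset k (mem [set: 'I_p]%SET)| <= d)%N.
  rewrite /small_image /d; move: #|_| => a; rewrite -leq_double => h.
  by lia.
pose comp (fh : {ffun 'I_d -> 'I_n} * {ffun 'I_p -> 'I_d}) :
  {ffun 'I_p -> 'I_n} := [ffun r => fh.1 (fh.2 r)].
apply: (@leq_trans #|finset.imset comp (mem [set: _]%SET)|); last first.
  apply: leq_trans (leq_imset_card _ _) _.
  by rewrite cardsT card_prod !card_ffun !card_ord.
apply: subset_leq_card; apply/fintype.subsetP => k.
rewrite inE => /smallE/andP[p0 kd].
have r0 : 'I_p by exact: (Ordinal p0).
set im := finset.imset k (mem [set: 'I_p]%SET) in kd.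
have kim r : k r \in enum im by rewrite mem_enum; apply: imset_f; rewrite inE.
have idx r : (index (k r) (enum im) < d)%N.
  by apply: leq_trans kd; rewrite cardE index_mem.
apply/imsetP; exists ([ffun i : 'I_d => nth (k r0) (enum im) i],
  [ffun r => Ordinal (idx r)]); first by rewrite inE.
by apply/ffunP => r; rewrite !ffunE /= nth_index.
Qed.

End SmallImages.

(** * Central limit theorem for abstract moment functionals *)

Lemma cvg_bigsum (K : numFieldType) (V : pseudoMetricNormedZmodType K) (I : Type)
    (r : seq I) (P : pred I) (f : I -> nat -> V) (l : I -> V) :
  (forall i, P i -> f i @ \oo --> l i) ->
  (fun n => \sum_(i <- r | P i) f i n) @ \oo --> \sum_(i <- r | P i) l i.
Proof.
move=> fl; elim: r => [|i r IH].
  by under eq_fun do rewrite big_nil; rewrite big_nil; exact: cvg_cst.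
rewrite big_cons; under eq_fun do rewrite big_cons.
case: ifPn => [/fl Pi|_]; last exact: IH.
exact: cvgD.
Qed.

Lemma normc_real (R : rcfType) (x : R) : `|x%:C| = (`|x|)%:C.
Proof. by rewrite normc_def /= expr0n addr0 sqrtr_sqr. Qed.

Lemma cvg_real_complex_squeeze (R : realType) (X : nat -> R[i]) (a : nat -> R)
    (l K : R) : a @ \oo --> l ->
  (forall n, (0 < n)%N -> `|X n - (a n)%:C| <= (K * (Num.sqrt n%:R)^-1)%:C) ->
  (X : nat -> R[i]^o) @ \oo --> (l%:C : R[i]^o).
Proof.
move=> al XK; apply/cvgrPdist_lt => eps; rewrite ltcE /= => /andP[/eqP im0 e0].
set e := complex.Re eps in e0; have -> : eps = e%:C.
  by rewrite {1}[eps]complexE im0 mulr0 addr0.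
have e20 : 0 < e / 2 by rewrite divr_gt0.
(* Once the square root of n exceeds [c], the error term is below [e / 2]. *)
pose c := (`|K| + 1) / (e / 2).
have c0 : 0 < c by rewrite divr_gt0 // ltr_wpDl.
near=> n.
have n0 : (0 < n)%N by near: n; exact: nbhs_infty_gt.
have sn0 : 0 < Num.sqrt n%:R :> R by rewrite sqrtr_gt0 ltr0n.
have csn : c < Num.sqrt n%:R.
  rewrite -[c]ger0_norm ?ltW // -sqrtr_sqr ltr_sqrt ?ltr0n //.
  by near: n; exact: nbhs_infty_gtr.
have Kn : K * (Num.sqrt n%:R)^-1 < e / 2.
  rewrite ltr_pdivrMr //; apply: le_lt_trans (ler_norm K) _.
  apply: lt_trans (_ : `|K| + 1 < _); first by rewrite ltrDl.
  by rewrite mulrC -ltr_pdivrMr.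
have an : `|l - a n| < e / 2.
  by near: n; move/cvgrPdist_lt : al; apply.
rewrite -[l%:C](subrK ((a n)%:C)) -addrA (le_lt_trans (ler_normD _ _)) //.
rewrite -rmorphB /= normc_real [e]splitr rmorphD /=; apply: ltr_leD.
  by rewrite ltcR.
rewrite distrC; apply: le_trans (XK n n0) _.
by rewrite lecR ltW.
Unshelve. all: by end_near.
Qed.

Section CentralLimit.
Context {R : realType}.
Variables (L : nat) (gL : sgraph 'I_L) (g : forall n, sgraph 'I_n).
Variables (w : graphon R) (s : R) (m : forall n, seq ('I_n * 'I_L) -> R[i]).
Hypothesis g_cvg : cvg_graphon g w.
Hypothesis m_bound : forall N, exists C : R, forall n (u : seq ('I_n * 'I_L)),
  (size u <= N)%N -> `|m u| <= C%:C.
Hypothesis m_single : forall n v (u : seq ('I_n * 'I_L)),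
  count_mem v u = 1%N -> m u = 0.
Hypothesis m_pairs : forall n (u : seq ('I_n * 'I_L)),
  (forall v, v \in u -> count_mem v u = 2%N) ->
  m u = if `[< crossings_adjacent (nested_adjacent gL (g n)) u >]
        then s%:C ^+ size u else 0.

Variables (p : nat) (J : 'I_p -> nonempty_set L) (alpha : 'I_p -> bool).
Hypothesis p_gt0 : (0 < p)%N.

Let adm := admissible_partition J gL alpha.

Lemma sqrt_pow_half n (pi : {set {set 'I_p}}) : (0 < n)%N -> pair_partition pi ->
  (Num.sqrt n%:R)^-1 ^+ p = (n%:R ^+ #|{: block pi}|)^-1 :> R.
Proof.
move=> n0 pp; rewrite exprVn -{1}(card_block pp) -muln2 mulnC exprM.
by rewrite sqr_sqrtr.
Qed.

(** Since p exceeds twice [p.-1./2] by 1 or 2, at least one factor n^(-1/2) remains. *)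
Lemma sqrt_pow_small n : (0 < n)%N ->
  (Num.sqrt n%:R)^-1 ^+ p * (n ^ p.-1./2)%:R <= (Num.sqrt n%:R)^-1 :> R.
Proof.
move=> n0; set q := Num.sqrt _.
have q1 : 1 <= q by rewrite -[1]sqrtr1 ler_sqrt // ler1n.
have q0 : 0 < q by apply: lt_le_trans q1.
have -> : (n ^ p.-1./2)%:R = q ^+ p.-1./2.*2 :> R.
  by rewrite natrX -muln2 mulnC exprM sqr_sqrtr.
have pE : p = (p.-1./2.*2 + (odd p.-1).+1)%N.
  by rewrite addnS addnC odd_double_half prednK.
rewrite {1}pE exprD mulrAC -exprMn mulVf ?gt_eqF // expr1n mul1r exprS.
rewrite ger_pMr ?invr_gt0 //; apply: exprn_ile1; first by rewrite invr_ge0 ltW.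
by rewrite invf_le1.
Qed.

(** After exchanging the sums, n^(-p/2) is the normalization of the density of a graph with p/2
    vertices, one per block. *)
Lemma main_term n : (0 < n)%N ->
  (Num.sqrt n%:R)^-1%:C ^+ p *
    (\sum_(k : {ffun 'I_p -> 'I_n})
       \sum_(pi | adm pi && constant_on k pi)
         s%:C ^+ total_label J * (meeting_edges J (g n) k pi)%:R) =
  (s ^+ total_label J *
    \sum_(pi | adm pi) graph_density (meeting_graph J pi) (g n))%:C.
Proof.
move=> n0; rewrite (exchange_big_dep adm) /=; last by move=> ? ? _ /andP[].
rewrite !mulr_sumr rmorph_sum; apply: eq_bigr => pi ad.
have pp : pair_partition pi by case/and4P: ad.
rewrite -rmorphXn (sqrt_pow_half n0 pp) -mulr_sumr mulrCA.
rewrite -rmorphXn /= (_ : \sum_(i | _) _ = (\sum_(i : {ffun 'I_p -> 'I_n} |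
  constant_on i pi) (meeting_edges J (g n) i pi)%:R)%:C).
  by rewrite -!rmorphM /= (sum_constant_on J pp) /graph_density card_ord.
rewrite rmorph_sum; apply: eq_big => [k|k _]; first by rewrite ad.
by rewrite rmorph_nat.
Qed.

(** Outside [small_image] the moments equal the pair sums exactly; the remaining choices are of
    order n^((p-1)/2) at most and contribute O(n^(-1/2)). The functional [m] is abstract because the
    result serves both the given variables and the involution model. *)
Theorem moments_cvg :
  (fun n => (Num.sqrt n%:R)^-1%:C ^+ p *
     \sum_(k : {ffun 'I_p -> 'I_n}) m (labelled_word J alpha k) : R[i]^o) @ \oo -->
  ((s ^+ total_label J * \sum_(pi | adm pi) partition_integral w J pi)%:C : R[i]^o).
Proof.
have [C hC] := m_bound (total_label J).
have C0 : 0 <= C.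
  by rewrite -(ler0c C); exact: le_trans (normr_ge0 _) (hC 0%N [::] isT).
(* [C] bounds the moment and the sum bounds the pair-partition expression that is subtracted from
   it. *)
pose B := C + \sum_(pi : {set {set 'I_p}}) `|s| ^+ total_label J.
apply: (@cvg_real_complex_squeeze _ _ (fun n => s ^+ total_label J *
    \sum_(pi | adm pi) graph_density (meeting_graph J pi) (g n)) _
    ((p.-1./2 ^ p)%:R * B)).
  apply: cvgM; first exact: cvg_cst.
  under eq_bigr do rewrite partition_integralE.
  exact: cvg_bigsum.
move=> n n0; rewrite -main_term // -mulrBr -sumrB normrM normrX normc_real.
rewrite (bigID (fun k : {ffun 'I_p -> 'I_n} => small_image k)) /=.
rewrite [X in _ + X]big1 ?addr0 => [|k ns]; last first.
  by rewrite (moment_pair_sum J alpha (@m_single n) (@m_pairs n) ns) subrr.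
have DB (k : {ffun 'I_p -> 'I_n}) : `|m (labelled_word J alpha k) -
   \sum_(pi | adm pi && constant_on k pi)
         s%:C ^+ total_label J * (meeting_edges J (g n) k pi)%:R| <= B%:C.
  apply: le_trans (ler_normB _ _) _; rewrite rmorphD; apply: lerD.
    by apply: hC; rewrite size_labelled_word.
  apply: le_trans (ler_norm_sum _ _ _) _; rewrite rmorph_sum big_mkcond /=.
  apply: ler_sum => pi _; case: ifP => _; last by rewrite ler0c exprn_ge0.
  rewrite normrM normrX normc_real rmorphXn /= normr_nat.
  by rewrite ler_piMr ?exprn_ge0 ?ler0c //; case: meeting_edges.
apply: le_trans (_ : ((Num.sqrt n%:R)^-1 ^+ p *
  ((n ^ p.-1./2 * p.-1./2 ^ p)%:R * B))%:C <= _).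
  rewrite rmorphM -rmorphXn ger0_norm ?invr_ge0 ?sqrtr_ge0 //.
  apply: ler_wpM2l; first by rewrite ler0c exprn_ge0 ?invr_ge0 ?sqrtr_ge0.
  apply: le_trans (ler_norm_sum _ _ _) _.
  apply: le_trans (ler_sum _ (fun k _ => DB k)) _.
  rewrite -rmorph_sum lecR sumr_const -(mulr_natl B); apply: ler_wpM2r.
    by rewrite addr_ge0 ?sumr_ge0 // => *; rewrite exprn_ge0.
  rewrite ler_nat; apply: leq_trans (card_small_image p n).
  by apply: subset_leq_card; apply/fintype.subsetP => k; rewrite inE.
rewrite lecR natrM mulrA mulrA -mulrA [X in _ <= X]mulrC.
apply: ler_wpM2r; last exact: sqrt_pow_small.
rewrite mulr_ge0 //.
by rewrite addr_ge0 ?sumr_ge0 // => *; rewrite exprn_ge0.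
Qed.

End CentralLimit.

(** * Free *-algebras *)

(** The free monoid on [T], whose monoid algebra is the free algebra. *)
Definition word (T : choiceType) : Type := seq T.
HB.instance Definition _ (T : choiceType) := Choice.on (word T).

Lemma cat_eq_nil (T : choiceType) (u v : word T) :
  u ++ v = [::] -> u = [::] /\ v = [::].
Proof. by case: u v => [|a u] [|b v]. Qed.

HB.instance Definition _ (T : choiceType) :=
  @Choice_isMonomialDef.Build (word T) [::] cat (@catA T) (@cat0s T) (@cats0 T)
    (@cat_eq_nil T).

Section AdditiveExtension.
Variables (K : choiceType) (G U : zmodType) (F : K -> {additive G -> U}).

(** Coefficients are only mapped additively, which covers the conjugate-linear adjoint as well as
    the state. *)
Definition malg_ext (x : {malg G[K]}) : U := \sum_(k <- msupp x) F k x@_k.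

Lemma malg_extEw (d : {fset K}) x : fsubset (msupp x) d ->
  malg_ext x = \sum_(k <- d) F k x@_k.
Proof.
move=> le; rewrite [LHS](big_fset_incl _ le) => //= k kd /mcoeff_outdom ->.
by rewrite raddf0.
Qed.

Lemma malg_ext_is_additive : additive malg_ext.
Proof.
move=> x y; pose d := fsetU (msupp (x - y)) (fsetU (msupp x) (msupp y)).
rewrite (@malg_extEw d) ?(@malg_extEw d x) ?(@malg_extEw d y).
- by rewrite -sumrB; apply: eq_bigr => k _; rewrite mcoeffB raddfB.
- exact: fsubset_trans (fsubsetUr _ _) (fsubsetUr _ _).
- exact: fsubset_trans (fsubsetUl _ _) (fsubsetUr _ _).
- exact: fsubsetUl.
Qed.

HB.instance Definition _ :=
  GRing.isZmodMorphism.Build {malg G[K]} U malg_ext malg_ext_is_additive.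

Lemma malg_extU c k : malg_ext << c *g k >> = F k c.
Proof. by rewrite (malg_extEw msuppU_le) big_seq_fset1 mcoeffUU. Qed.

End AdditiveExtension.

Lemma malg_additive_eq (K : choiceType) (G U : zmodType) (f g : {malg G[K]} -> U) :
  {morph f : x y / x + y} -> {morph g : x y / x + y} ->
  (forall c k, f << c *g k >> = g << c *g k >>) -> f =1 g.
Proof.
move=> fD gD fg x; rewrite [x]monalgE.
apply: (big_ind (fun z => f z = g z)) => [|y z fgy fgz|k _]; last exact: fg.
  have zero (h : {malg G[K]} -> U) : {morph h : x y / x + y} -> h 0 = 0 :> U.
    move=> hD; have : h 0 + h 0 = h 0 + 0 by rewrite -hD !addr0.
    exact: addrI.
  by rewrite !zero.
by rewrite fD gD fgy fgz.
Qed.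

Section FreeAlgebra.
Context {R : realType}.
Variables (T : choiceType) (st : T -> T) (Phi : seq T -> R[i]).
Hypothesis stK : involutive st.

Local Notation FA := {malg R[i][word T]}.

Lemma malg_scalerAr : forall k (x y : FA), k *: (x * y) = x * (k *: y).
Proof.
have central c (x : FA) : x * c%:MP = c *: x.
  rewrite malgM_def fgmulgU [in RHS](monalgE x) scaler_sumr.
  apply: eq_bigr => u _; rewrite mulm1; apply/malgP => v.
  by rewrite mcoeffZ !mcoeffU mulrC mulrnAr.
by move=> k x y; rewrite -[k *: y]mul_malgC mulrA central scalerAl.
Qed.

(* An alias of malg: monalg only declares an algebra structure on malg for
   commutative monoids, and it would take precedence. *)
Definition free_algebra : Type := FA.
HB.instance Definition _ := GRing.Lalgebra.copy free_algebra FA.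
HB.instance Definition _ :=
  GRing.Lalgebra_isAlgebra.Build R[i] free_algebra malg_scalerAr.

Definition star_word (u : word T) : word T := rev (map st u).

Lemma star_wordK : involutive star_word.
Proof.
by move=> u; rewrite /star_word map_rev revK -map_comp map_id_in // => t _; exact: stK.
Qed.

Lemma star_word_cat (u v : word T) : star_word (u ++ v) = star_word v ++ star_word u.
Proof. by rewrite /star_word map_cat rev_cat. Qed.

Definition adj_coef (u : word T) (c : R[i]) : FA := << c^* *g star_word u >>.
Definition tau_coef (u : word T) (c : R[i]) : R[i] := c * Phi u.

Lemma adj_coef_additive u : additive (adj_coef u).
Proof. by move=> c d; rewrite /adj_coef rmorphB monalgUB. Qed.
Lemma tau_coef_additive u : additive (tau_coef u).
Proof. by move=> c d; rewrite /tau_coef mulrBl. Qed.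
HB.instance Definition _ u :=
  GRing.isZmodMorphism.Build R[i] FA (adj_coef u) (adj_coef_additive u).
HB.instance Definition _ u :=
  GRing.isZmodMorphism.Build R[i] R[i] (tau_coef u) (tau_coef_additive u).

Definition free_adj : FA -> FA := malg_ext adj_coef.
Definition free_tau : FA -> R[i] := malg_ext tau_coef.
HB.instance Definition _ := GRing.Additive.on free_adj.
HB.instance Definition _ := GRing.Additive.on free_tau.

Lemma free_adjU c u : free_adj << c *g u >> = << c^* *g star_word u >>.
Proof. exact: malg_extU. Qed.

Lemma free_tauU c u : free_tau << c *g u >> = c * Phi u.
Proof. exact: malg_extU. Qed.

Lemma malgUM c d (u v : word T) :
  << c *g u >> * << d *g v >> = << c * d *g (u ++ v : word T) >> :> FA.
Proof. by rewrite malgM_def fgmulUU. Qed.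

Lemma malgUZ (c d : R[i]) (u : word T) : c *: << d *g u >> = << c * d *g u >> :> FA.
Proof. by apply/malgP => v; rewrite mcoeffZ !mcoeffU mulrnAr. Qed.

Lemma free_adjK : involutive free_adj.
Proof.
apply: malg_additive_eq => [x y|//|c u]; first by rewrite !raddfD.
by rewrite !free_adjU conjCK star_wordK.
Qed.

Lemma free_adjZ c x : free_adj (c *: x) = c^* *: free_adj x.
Proof.
move: x; apply: malg_additive_eq => [x y|x y|d u].
- by rewrite scalerDr raddfD.
- by rewrite raddfD scalerDr.
- by rewrite malgUZ !free_adjU malgUZ rmorphM.
Qed.

Lemma free_adjM x y : free_adj (x * y) = free_adj y * free_adj x.
Proof.
move: x; apply: malg_additive_eq => [x x'|x x'|c u].
- by rewrite mulrDl raddfD.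
- by rewrite raddfD mulrDr.
move: y; apply: malg_additive_eq => [y y'|y y'|d v].
- by rewrite mulrDr raddfD.
- by rewrite raddfD mulrDl.
- by rewrite malgUM !free_adjU malgUM rmorphM mulrC star_word_cat.
Qed.

Lemma free_tau_linear : linear_for *%R free_tau.
Proof.
move=> c x y; rewrite raddfD /=; congr (_ + _); move: x.
apply: malg_additive_eq => [x x'|x x'|d u].
- by rewrite scalerDr raddfD.
- by rewrite raddfD mulrDr.
- by rewrite malgUZ !free_tauU mulrA.
Qed.

HB.instance Definition _ :=
  GRing.isLinear.Build R[i] FA R[i] *%R free_tau free_tau_linear.

Hypothesis Phi1 : Phi [::] = 1.
Hypothesis Phi_ge0 : forall (d : seq (seq T)) (x : seq T -> R[i]),
  0 <= \sum_(u <- d) \sum_(v <- d) (x u)^* * x v * Phi (star_word u ++ v).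

Lemma free_tau1 : free_tau 1 = 1.
Proof. by rewrite [1]/(<< 1 *g _ >>) free_tauU Phi1 mulr1. Qed.

Lemma free_tau_ge0 x : 0 <= free_tau (free_adj x * x).
Proof.
have := Phi_ge0 (msupp x) (fun u => x@_u).
congr (0 <= _).
have adjE : free_adj x = \sum_(u <- msupp x) << (x@_u)^* *g star_word u >>.
  by [].
rewrite adjE [X in free_tau (_ * X)]monalgE mulr_suml.
rewrite [RHS](raddf_sum free_tau) /=; apply: eq_bigr => u _.
rewrite mulr_sumr (raddf_sum free_tau) /=; apply: eq_bigr => v _.
by rewrite malgUM free_tauU.
Qed.

Definition free_space : ncProbSpace R :=
  @NCProbSpace R free_algebra free_adj free_tau free_adjK (raddfD _) free_adjZ free_adjM
    free_tau1 free_tau_ge0.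

End FreeAlgebra.

(** A normalized positive functional on words extends linearly to a state of the free algebra, where
    the adjoint reverses words and applies [st] to letters. *)
Lemma free_space_exists (R : realType) (T : choiceType) (st : T -> T)
    (Phi : seq T -> R[i]) :
  involutive st -> Phi [::] = 1 ->
  (forall (d : seq (seq T)) (x : seq T -> R[i]),
     0 <= \sum_(u <- d) \sum_(v <- d) (x u)^* * x v * Phi (rev (map st u) ++ v)) ->
  exists (B : ncProbSpace R) (gen : T -> B),
    (forall t, adj (gen t) = gen (st t)) /\
    (forall u : seq T, tau B (\prod_(t <- u) gen t) = Phi u).
Proof.
move=> stK Phi1 Phi_ge0; exists (free_space stK Phi1 Phi_ge0).
exists (fun t => << ([:: t] : word T) >>); split=> [t|u].
  by rewrite /= free_adjU rmorph1.
suff -> : \prod_(t <- u) << ([:: t] : word T) >> = << (u : word T) >> :> {malg R[i][word T]}.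
  by rewrite /= free_tauU mul1r.
elim: u => [|t u IH]; first by rewrite big_nil.
by rewrite big_cons IH malgUM mul1r.
Qed.

(** * A model with involutions *)

Section InvolutionModel.
Variables (V : finType) (e : rel V).
Hypotheses (e_sym : symmetric e) (e_irr : irreflexive e).

Local Notation G3 := {perm 'I_3}.

Let s1 : G3 := tperm (inord 0) (inord 1).
Let s2 : G3 := tperm (inord 1) (inord 2).

(* Any two letters a, b that are not adjacent (in particular a = b) have a
   coordinate in S_3, in which they act by transpositions that do not commute
   and all other letters act trivially. *)
Definition coordinate (ab : V * V) (v : V) : G3 :=
  if v == ab.1 then s1 else if v == ab.2 then s2 else 1%g.

(** The image of a word in a product of copies of S_3. Coordinates of adjacent pairs are
    trivialized, so that adjacent letters commute. *)
Definition coordinate_word (u : seq V) : {ffun V * V -> G3} :=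
  [ffun ab => if e ab.1 ab.2 then 1%g else (\prod_(v <- u) coordinate ab v)%g].

Lemma coordinate_invol ab v : (coordinate ab v * coordinate ab v = 1)%g.
Proof.
by rewrite /coordinate; case: eqP => _; last case: eqP => _;
  rewrite ?tperm2 ?mulg1.
Qed.

Lemma prod_coordinate_rev ab u :
  (\prod_(v <- rev u) coordinate ab v = (\prod_(v <- u) coordinate ab v)^-1)%g.
Proof.
elim: u => [|v u IH]; first by rewrite /rev /= !big_nil invg1.
rewrite rev_cons -cats1 big_cat big_seq1 big_cons invMg IH /=.
by congr (_ * _)%g; apply/esym/eqP; rewrite eq_invg_mul coordinate_invol.
Qed.

(** Letters act by involutions, so reversal is inversion and the pairing of two words tests equality
    of their images. *)
Lemma coordinate_word_rev_cat u v :
  (coordinate_word (rev u ++ v) == coordinate_word [::]) =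
  (coordinate_word u == coordinate_word v).
Proof.
apply/eqP/eqP => /ffunP h; apply/ffunP => ab; have := h ab; rewrite !ffunE;
  case: ifP => // _; rewrite big_cat big_nil prod_coordinate_rev /=.
  by move/eqP; rewrite -eq_invg_mul invgK => /eqP.
by move=> ->; rewrite mulVg.
Qed.

Lemma coordinate_word1P u : reflect
  (forall a b, ~~ e a b -> (\prod_(v <- u) coordinate (a, b) v)%g = 1%g)
  (coordinate_word u == coordinate_word [::]).
Proof.
apply: (iffP eqP) => [/ffunP h a b /negPf nab|h].
  by have := h (a, b); rewrite !ffunE /= nab big_nil.
apply/ffunP => -[a b]; rewrite !ffunE /= big_nil.
by case: ifPn => // /h.
Qed.

(** The coordinate (v, v) sees only the letter [v], and equals the transposition [s1] here. *)
Lemma coordinate_word_singleton v u : count_mem v u = 1%N ->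
  (coordinate_word u == coordinate_word [::]) = false.
Proof.
move=> cu; apply/negP => /coordinate_word1P/(_ v v); rewrite e_irr => /(_ isT).
have -> : (\prod_(x <- u) coordinate (v, v) x = s1 ^+ count_mem v u)%g.
  elim: u {cu} => [|x u IH]; first by rewrite big_nil.
  rewrite big_cons IH /= expgD /coordinate /=.
  by case: eqP => _; rewrite ?expg1 ?expg0.
rewrite cu expg1 => /permP/(_ (inord 0)); rewrite tpermL perm1.
by move/(congr1 val) => /=; rewrite !inordK.
Qed.

(** A crossing a b a b of non-adjacent letters gives s1 s2 s1 s2, which is not 1, in the coordinate
    (a, b). If all crossings are adjacent, a nonempty word is not reduced, and deleting a mergeable
    pair preserves the image. *)
Lemma coordinate_word_pairs u : (forall v, v \in u -> count_mem v u = 2%N) ->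
  (coordinate_word u == coordinate_word [::]) = `[< crossings_adjacent e u >].
Proof.
move=> cu; apply/coordinate_word1P/asboolP => [triv a b abab|].
  apply: contraT => nab.
  have [ab|ab] := eqVneq a b.
    have au : a \in u by apply: (mem_subseq abab); rewrite mem_head.
    have := leq_count_subseq (pred1 a) abab.
    by rewrite (cu a au) /= -ab eqxx.
  have au : a \in u by apply: (mem_subseq abab); rewrite mem_head.
  have bu : b \in u by apply: (mem_subseq abab); rewrite !inE eqxx orbT.
  (* Both letters occur twice, so the pattern exhausts their occurrences. *)
  have fE : [:: a; b; a; b] = [seq x <- u | pred2 a b x].
    have sub : subseq [:: a; b; a; b] [seq x <- u | pred2 a b x].
      by rewrite subseq_filter abab /= !eqxx !orbT.
    apply/eqP; rewrite -(size_subseq_leqif sub) size_filter.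
    have -> : count (pred2 a b) u = (count_mem a u + count_mem b u)%N.
      rewrite -count_predUI [X in (_ + X)%N](eq_count (a2 := pred0)) => [|x /=].
        by rewrite count_pred0 addn0.
      by have [->|//] := eqVneq x a; rewrite (negPf ab).
    by rewrite !cu.
  have filt : (\prod_(x <- u) coordinate (a, b) x =
      \prod_(x <- [seq x <- u | pred2 a b x]) coordinate (a, b) x)%g.
    rewrite big_filter [RHS]big_mkcond; apply: eq_bigr => x _ /=.
    by rewrite /coordinate /=; case: (x == a) => //; case: (x == b).
  have := triv a b nab; rewrite filt -fE !big_cons big_nil mulg1 /coordinate /=.
  rewrite !eqxx (eq_sym b a) (negPf ab) => /permP/(_ (inord 0)).
  rewrite !permM perm1 tpermL tpermL [s1 _]tpermD ?tpermR.
    by move/(congr1 val) => /=; rewrite !inordK.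
  by rewrite -val_eqE /= !inordK.
  by rewrite -val_eqE /= !inordK.
move=> ca; have [N] := ubnP (size u); elim: N u cu ca => [//|N IH] u cu ca uN a b nab.
have [->|u0] := eqVneq u [::]; first by rewrite big_nil.
have /(not_reduced (f := id)) : ~~ reduced e (map id u).
  rewrite map_id; apply: contraT; rewrite negbK => r.
  have [x [y [xy nxy]]] := reduced_crossing u0 r cu.
  by rewrite (ca x y xy) in nxy.
case=> P [v [M [v' [Q [uE /= vv' aM]]]]].
rewrite -{v'}vv' map_id in uE aM.
have vn : v \notin P ++ M ++ Q.
  apply/count_memPn; have := cu v.
  rewrite uE !(mem_cat, inE) eqxx orbT => /(_ isT).
  by rewrite !count_cat /= !count_cat /= eqxx; lia.
have cu' x : x \in P ++ M ++ Q -> count_mem x (P ++ M ++ Q) = 2%N.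
  move=> xw; have xv : x != v by apply: contraNneq vn => <-.
  have := cu x; rewrite uE !(mem_cat, inE) (negPf xv).
  rewrite !count_cat /= !count_cat /= (eq_sym v x) (negPf xv) !add0n; apply.
  by move: xw; rewrite !mem_cat.
have ca' : crossings_adjacent e (P ++ M ++ Q).
  by apply/(crossings_adjacent_remove e_sym vn aM); rewrite -uE.
rewrite uE -[RHS](IH _ cu' ca' _ _ _ nab); last first.
  by move: uN; rewrite uE !size_cat /= !size_cat /= !addnS !ltnS => /ltnW.
rewrite !(big_cat, big_cons) /=; congr (_ * _)%g.
rewrite !mulgA; congr (_ * _)%g.
move: vn; rewrite !mem_cat !negb_or => /and3P[_ vM _].
(* If [v] is [a] or [b], every letter of [M] differs from both, being adjacent to [v] and not equal
   to it. So [M] acts trivially and the two copies of [v] cancel. *)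
have [va|nva] := eqVneq v a.
  rewrite big1_seq ?mulg1 ?coordinate_invol // => x /andP[_ xM].
  rewrite /coordinate /= -va; case: eqP => [xv|_]; first by rewrite -xv xM in vM.
  by case: eqP => // xb; rewrite -va -xb (allP aM) in nab.
have [vb|nvb] := eqVneq v b.
  rewrite big1_seq ?mulg1 ?coordinate_invol // => x /andP[_ xM].
  rewrite /coordinate /= -vb; case: eqP => [xa|_].
    by rewrite -vb -xa e_sym (allP aM) in nab.
  by case: eqP => // xv; rewrite -xv xM in vM.
have -> : coordinate (a, b) v = 1%g.
  by rewrite /coordinate /= (negPf nva) (negPf nvb).
by rewrite mul1g mulg1.
Qed.

End InvolutionModel.

(** Grouping by the value of [F] turns the form into a sum of squared moduli. *)
Lemma indicator_positive (R : realType) (X : Type) (H : finType) (F : X -> H)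
    (d : seq X) (x : X -> R[i]) :
  0 <= \sum_(u <- d) \sum_(v <- d) (x u)^* * x v * (F u == F v)%:R.
Proof.
have -> : \sum_(u <- d) \sum_(v <- d) (x u)^* * x v * (F u == F v)%:R =
    \sum_(h : H) (\sum_(u <- d) x u * (F u == h)%:R)^* *
      (\sum_(u <- d) x u * (F u == h)%:R).
  under [RHS]eq_bigr => h _ do rewrite rmorph_sum mulr_suml.
  rewrite [RHS]exchange_big; apply: eq_bigr => u _ /=.
  under [RHS]eq_bigr => h _ do rewrite mulr_sumr.
  rewrite [RHS]exchange_big; apply: eq_bigr => v _ /=.
  rewrite (bigD1 (F u)) //= eqxx big1 ?addr0 => [|h /negPf nh].
    by rewrite mulr1 mulrA eq_sym.
  by rewrite eq_sym nh mulr0 rmorph0 mul0r.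
by apply: sumr_ge0 => h _; rewrite mulrC mul_conjC_ge0.
Qed.

(** * The limit theorem *)

(** No law is asked of [op]: the products of letters do not commute, and the enumeration preserves
    their order. *)
Lemma big_enum_ordered (T : Type) (idx : T) (op : T -> T -> T) (I : finType)
    (A : {pred I}) (F : I -> T) :
  \big[op/idx]_(i <- enum A) F i = \big[op/idx]_(i in A) F i.
Proof. by rewrite -[RHS]big_filter /enum_mem [index_enum _]unlock. Qed.

(** * Adjoints and normalized sums over one label set *)

Section Adjoint.
Context {R : realType} {A : ncProbSpace R}.

Lemma adj_one : adj (1 : A) = 1.
Proof. by have := Defs.adjM 1 (adj (1 : A)); rewrite mul1r !Defs.adjK mul1r. Qed.

Lemma adj_zero : adj (0 : A) = 0.
Proof. by apply: (addrI (adj 0)); rewrite -Defs.adjD !addr0. Qed.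

Lemma adj_sum (I : Type) (r : seq I) (P : pred I) (f : I -> A) :
  adj (\sum_(i <- r | P i) f i) = \sum_(i <- r | P i) adj (f i).
Proof. exact: (big_morph _ (@Defs.adjD _ A) adj_zero). Qed.

Lemma adj_prod (I : Type) (r : seq I) (f : I -> A) :
  adj (\prod_(i <- r) f i) = \prod_(i <- rev r) adj (f i).
Proof.
elim: r => [|i r IH]; first by rewrite big_nil adj_one /rev big_nil.
by rewrite big_cons Defs.adjM IH rev_cons -cats1 big_cat big_seq1.
Qed.

Lemma adjZr (c : R) (x : A) : adj (c%:C *: x) = c%:C *: adj x.
Proof. by rewrite Defs.adjZ; congr (_ *: _); rewrite /Num.conj /= oppr0. Qed.

Lemma star_pow_sum (I : finType) (t : bool) (c : I -> R) (x : I -> A) :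
  star_pow t (\sum_i (c i)%:C *: x i) = \sum_i (c i)%:C *: star_pow t (x i).
Proof.
case: t => //=; rewrite adj_sum; apply: eq_bigr => i _; exact: adjZr.
Qed.

Lemma tau_prod_sum (p : nat) (I : finType) (c : I -> R) (x : 'I_p -> I -> A) :
  tau A (\prod_(r < p) \sum_i (c i)%:C *: x r i) =
  \sum_(f : {ffun 'I_p -> I}) (\prod_(r < p) c (f r))%:C *
    tau A (\prod_(r < p) x r (f r)).
Proof.
rewrite bigA_distr_bigA linear_sum; apply: eq_bigr => f _.
by rewrite scaler_prod linearZ rmorph_prod.
Qed.

Variables (n L : nat) (y : 'I_n * 'I_L -> A).

(** For self-adjoint [y], the counterpart at finite n of s_I, or of its adjoint if [t] is true. *)
Definition label_sum (t : bool) (I : {set 'I_L}) : A :=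
  (Num.sqrt n%:R)^-1%:C *: \sum_(k < n) \prod_(l <- label_seq t I) y (k, l).

Lemma tau_prod_label_sum p (J : 'I_p -> nonempty_set L) (alpha : 'I_p -> bool) :
  tau A (\prod_(r < p) label_sum (alpha r) (val (J r))) =
  (Num.sqrt n%:R)^-1%:C ^+ p *
    \sum_(k : {ffun 'I_p -> 'I_n}) tau A (\prod_(v <- labelled_word J alpha k) y v).
Proof.
rewrite scaler_prod prodr_const card_ord linearZ /=; congr (_ * _).
rewrite bigA_distr_bigA linear_sum; apply: eq_bigr => k _; congr (tau A _).
rewrite big_map big_flatten big_map big_enum_ordered.
by apply: eq_bigr => r _; rewrite big_map.
Qed.

Lemma star_label_sum t I : (forall v, adj (y v) = y v) ->
  star_pow t (label_sum false I) = label_sum t I.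
Proof.
move=> ya; case: t => //=; rewrite /label_sum adjZr adj_sum.
congr (_ *: _); apply: eq_bigr => k _; rewrite adj_prod.
by apply: eq_bigr => l _; exact: ya.
Qed.

Lemma adj_label_sum t I : (forall v, adj (y v) = y v) ->
  adj (label_sum t I) = label_sum (~~ t) I.
Proof.
move=> ya; rewrite -(star_label_sum t I ya); case: t => /=; first by rewrite Defs.adjK.
exact: (star_label_sum true I ya).
Qed.

End Adjoint.

Section Normalization.
Context {R : realType} (A : ncProbSpace R) (n L : nat).
Variables (lambda : R) (x : 'I_n -> 'I_L -> A).

(** Each factor is its centered part plus [lambda]; the product expands over subsets, and the empty
    subset yields the subtracted [lambda ^+ L]. *)
Lemma normalized_sumE : normalized_sum lambda x =
  \sum_(J : nonempty_set L) (lambda ^+ #|~: val J|)%:C *: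
    label_sum (fun v => x v.1 v.2 - lambda%:C%:A) false (val J).
Proof.
pose y (v : 'I_n * 'I_L) : A := x v.1 v.2 - lambda%:C%:A.
have prodE k : \prod_(l < L) x k l = \sum_(J : {set 'I_L})
    (lambda ^+ #|~: J|)%:C *: \prod_(l <- enum J) y (k, l).
  under eq_bigr => l _ do rewrite -[x k l](subrK lambda%:C%:A) -[_ - _]/(y (k, l)).
  rewrite bigA_distr; apply: eq_bigr => J _.
  rewrite (eq_bigr (fun l => (if l \in J then 1 else lambda%:C) *:
    (if l \in J then y (k, l) else 1))) => [|l _]; last by case: ifP; rewrite ?scale1r.
  rewrite scaler_prod -big_mkcond big_enum_ordered /=; congr (_ *: _).
  rewrite rmorphXn -prodr_const big_mkcond [RHS]big_mkcond /=.
  by apply: eq_bigr => l _; rewrite inE; case: ifP.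
rewrite /normalized_sum /label_sum.
under [RHS]eq_bigr => J _ do rewrite scalerA mulrC -scalerA scaler_sumr.
rewrite -scaler_sumr exchange_big; congr (_ *: _); apply: eq_bigr => k _ /=.
rewrite prodE (bigD1 finset.set0) //= enum_set0 big_nil finset.setC0 cardsT card_ord.
rewrite addrAC subrr add0r.
by rewrite -(big_sub (fun J : {set 'I_L} => J != finset.set0) (fun J : {set 'I_L} =>
  (lambda ^+ #|~: J|)%:C *: \prod_(l <- enum J) y (k, l))).
Qed.

End Normalization.

(** A nonnegative sequence equals its modulus, hence so does its limit. *)
Lemma cvg_ge0_complex (R : realType) (X : nat -> R[i]) (l : R[i]) :
  (forall n, 0 <= X n) -> (X : nat -> R[i]^o) @ \oo --> (l : R[i]^o) -> 0 <= l.
Proof.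
move=> X0 Xl; have nXl := @cvg_norm _ R[i]^o _ _ _ _ _ Xl.
have XE : (fun n => `|X n| : R[i]^o) = X by apply/funext => n; rewrite ger0_norm.
rewrite XE in nXl.
have <- : `|l| = l by exact: (cvg_unique (@norm_hausdorff _ R[i]^o) (nXl _) Xl).
exact: normr_ge0.
Qed.

Section SpaceLimit.
Context {R : realType}.
Variables (L : nat) (gL : sgraph 'I_L) (g : forall n, sgraph 'I_n).
Variables (w : graphon R) (s : R) (A : nat -> ncProbSpace R).
Variable y : forall n, 'I_n * 'I_L -> A n.
Hypothesis g_cvg : cvg_graphon g w.
Hypothesis y_bound : forall N, exists C : R, forall n (u : seq ('I_n * 'I_L)),
  (size u <= N)%N -> `|tau (A n) (\prod_(v <- u) y v)| <= C%:C.
Hypothesis y_single : forall n v (u : seq ('I_n * 'I_L)),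
  count_mem v u = 1%N -> tau (A n) (\prod_(v <- u) y v) = 0.
Hypothesis y_pairs : forall n (u : seq ('I_n * 'I_L)),
  (forall v, v \in u -> count_mem v u = 2%N) ->
  tau (A n) (\prod_(v <- u) y v) =
  if `[< crossings_adjacent (nested_adjacent gL (g n)) u >]
  then s%:C ^+ size u else 0.

Lemma label_sum_cvg p (J : 'I_p -> nonempty_set L) (alpha : 'I_p -> bool) :
  (0 < p)%N ->
  (fun n => tau (A n) (\prod_(r < p) label_sum (@y n) (alpha r) (val (J r))) : R[i]^o)
    @ \oo -->
  ((s ^+ total_label J *
    \sum_(pi | admissible_partition J gL alpha pi) partition_integral w J pi)%:C
     : R[i]^o).
Proof.
move=> p0; under eq_fun do rewrite tau_prod_label_sum.
exact: (@moments_cvg R L gL g w s (fun n u => tau (A n) (\prod_(v <- u) y v))).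
Qed.

End SpaceLimit.

(** * Existence of the limit family *)

Section LimitFamily.
Context {R : realType}.
Variables (L : nat) (gL : sgraph 'I_L) (g : forall n, sgraph 'I_n) (w : graphon R).
Hypothesis g_cvg : cvg_graphon g w.

Lemma involution_space n : exists (A : ncProbSpace R) (y : 'I_n * 'I_L -> A),
  (forall v, adj (y v) = y v) /\
  (forall u, tau A (\prod_(v <- u) y v) =
     (coordinate_word (nested_adjacent gL (g n)) u ==
      coordinate_word (nested_adjacent gL (g n)) [::])%:R).
Proof.
apply: (@free_space_exists R _ id (fun u =>
  (coordinate_word (nested_adjacent gL (g n)) u ==
   coordinate_word (nested_adjacent gL (g n)) [::])%:R)) => //.
  by rewrite eqxx.
move=> d x; under eq_bigr => u _ do under eq_bigr => v _ do
  rewrite map_id coordinate_word_rev_cat.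
exact: indicator_positive.
Qed.

(** The involution model has unit variance, so its label sums have the prescribed limiting moments.
    These limits define a functional on words in the s_J and their adjoints, and positivity passes
    to the limit. *)
Lemma limit_family_exists : exists (B : ncProbSpace R) (s : nonempty_set L -> B),
  limit_joint_law gL w s.
Proof.
pose A n := projT1 (cid (involution_space n)).
pose y n := projT1 (cid (projT2 (cid (involution_space n)))) : 'I_n * 'I_L -> A n.
have ya n v : adj (y n v) = y n v.
  by have [h _] := projT2 (cid (projT2 (cid (involution_space n)))); exact: h.
have ytau n u : tau (A n) (\prod_(v <- u) y n v) =
     (coordinate_word (nested_adjacent gL (g n)) u ==
      coordinate_word (nested_adjacent gL (g n)) [::])%:R.
  by have [_ h] := projT2 (cid (projT2 (cid (involution_space n)))); exact: h.
have e_sym n : symmetric (nested_adjacent gL (g n)).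
  by apply: nested_adjacent_sym; exact: adjacent_sym.
have e_irr n : irreflexive (nested_adjacent gL (g n)).
  by apply: nested_adjacent_irr; exact: adjacent_irr.
have ycvg p J alpha p0 := @label_sum_cvg R L gL g w 1 A y g_cvg _ _ _ p J alpha p0.
have {}ycvg (p : nat) (J : 'I_p -> nonempty_set L) (alpha : 'I_p -> bool) : (0 < p)%N ->
  (fun n => tau (A n) (\prod_(r < p) label_sum (y n) (alpha r) (val (J r))) : R[i]^o)
    @ \oo --> ((\sum_(pi | admissible_partition J gL alpha pi)
       partition_integral w J pi)%:C : R[i]^o).
  move=> p0; rewrite -[X in X%:C]mul1r -(expr1n _ (total_label J)).
  apply: ycvg => // [N|n v u cu|n u cu]; rewrite ?ytau.
  - exists 1 => n u _; rewrite ytau normr_nat -(rmorph_nat (real_complex R)) lecR.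
    by rewrite lern1 leq_b1.
  - by rewrite (coordinate_word_singleton (e_irr n) cu).
  - rewrite (coordinate_word_pairs (e_sym n) cu) expr1n.
    by case: asboolP.
(* A letter is a label set with a flag that distinguishes s_J from its adjoint. *)
pose T : choiceType := (nonempty_set L * bool)%type.
pose S n (t : T) := label_sum (y n) t.2 (val t.1).
have [Phi PhiP] : {Phi : seq T -> R[i] & forall u,
    (fun n => tau (A n) (\prod_(t <- u) S n t) : R[i]^o) @ \oo --> (Phi u : R[i]^o)}.
  apply: (@boolp.choice (seq T) R[i] (fun u l =>
    (fun n => tau (A n) (\prod_(t <- u) S n t) : R[i]^o) @ \oo --> (l : R[i]^o))) => u.
  (* The convergence of moments is stated for p > 0, so the empty word is treated apart. *)
  have [u0|u0] := posnP (size u).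
    exists 1; rewrite (size0nil u0); under eq_fun do rewrite big_nil tau1.
    exact: cvg_cst.
  eexists; under eq_fun do rewrite big_tnth.
  exact: (ycvg _ (fun r => (tnth (in_tuple u) r).1) (fun r => (tnth (in_tuple u) r).2)).
pose st (t : T) : T := (t.1, ~~ t.2).
have [|||B [gen [gen_adj gen_tau]]] := @free_space_exists R T st Phi.
- by move=> [J a]; rewrite /st /= negbK.
- have nil1 : (fun n => tau (A n) (\prod_(t <- [::]) S n t) : R[i]^o) @ \oo -->
      (1 : R[i]^o).
    by under eq_fun do rewrite big_nil tau1; exact: cvg_cst.
  exact: (cvg_unique (@norm_hausdorff _ R[i]^o) (PhiP [::]) nil1).
- move=> d x.
  (* The quadratic form of [Phi] is the limit of the states of elements [adj z * z] in the
     models. *)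
  apply: (@cvg_ge0_complex _ (fun n => tau (A n)
    (adj (\sum_(u <- d) x u *: \prod_(t <- u) S n t) *
     (\sum_(u <- d) x u *: \prod_(t <- u) S n t)))) => [n|].
    exact: tau_ge0.
  have -> : (fun n => tau (A n) (adj (\sum_(u <- d) x u *: \prod_(t <- u) S n t) *
     (\sum_(u <- d) x u *: \prod_(t <- u) S n t)) : R[i]^o) =
     (fun n => \sum_(u <- d) \sum_(v <- d) (x u)^* * x v *
       tau (A n) (\prod_(t <- rev (map st u) ++ v) S n t)).
    apply/funext => n; rewrite adj_sum mulr_suml linear_sum; apply: eq_bigr => u _.
    rewrite mulr_sumr linear_sum; apply: eq_bigr => v _.
    rewrite Defs.adjZ -scalerAl -scalerAr scalerA linearZ /= adj_prod big_cat /=.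
    congr (_ * tau (A n) (_ * _)); rewrite -map_rev big_map.
    by apply: eq_bigr => t _; exact: adj_label_sum.
  apply: cvg_bigsum => u _; apply: cvg_bigsum => v _.
  by apply: cvgM; [exact: cvg_cst | exact: PhiP].
exists B, (fun J => gen (J, false)) => p J alpha p0.
transitivity (Phi [seq (J r, alpha r) | r <- enum 'I_p]).
  rewrite -gen_tau big_map big_enum_ordered; congr (tau B _).
  by apply: eq_bigr => r _; case: (alpha r) => //=; rewrite gen_adj.
have := ycvg p J alpha p0.
under eq_fun do rewrite -big_enum_ordered -(big_map (fun r => (J r, alpha r)) predT
  (S _)).
exact: (cvg_unique (@norm_hausdorff _ R[i]^o) (PhiP _)).
Qed.

End LimitFamily.

(** * Generated subalgebras and convergence of the normalized sums *)

Section GeneratedAlgebra.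
Context {R : realType} (A : ncProbSpace R) (x : A).

Lemma mem_generated : generated_by x x.
Proof. by move=> S [_ xS]; exact: xS. Qed.

Lemma generated_subset (S : set A) : subalgebra S -> S x -> generated_by x `<=` S.
Proof. by move=> Salg Sx; apply: smallest_sub => // z ->. Qed.

Lemma generated_subalgebra : subalgebra (generated_by x).
Proof.
split; rewrite ?inE.
- by move=> S [[+ _ _] _]; rewrite inE.
- move=> c u v; rewrite !inE => gu gv S [Salg xS].
  have [_ + _] := Salg; move=> /(_ c u v); rewrite !inE; apply.
    exact: gu.
  exact: gv.
- move=> u v; rewrite !inE => gu gv S [Salg xS].
  have [_ _] := Salg; move=> /(_ u v); rewrite !inE; apply.
    exact: gu.
  exact: gv.
Qed.

End GeneratedAlgebra.

Theorem theorem1p3 (R : realType) (A : ncProbSpace R)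
    (L : nat) (hL : (0 < L)%N) (gL : sgraph 'I_L)
    (g' : forall n : nat, sgraph 'I_n) (w : graphon R)
    (hg' : cvg_graphon g' w)
    (a : A) (lambda sigma : R)
    (ha : selfadjoint a)
    (hmean : tau A a = lambda%:C)
    (hvar : tau A (a ^+ 2) - tau A a ^+ 2 = (sigma ^+ 2)%:C)
    (Al : 'I_L -> set A)
    (hAl : forall l, subalgebra (Al l))
    (hAl_indep : graph_independent gL Al)
    (x : forall n : nat, 'I_n -> 'I_L -> A)
    (hx_mem : forall n (k : 'I_n) l, Al l (x n k l))
    (hx_sa : forall n (k : 'I_n) l, selfadjoint (x n k l))
    (hx_law : forall n (k : 'I_n) l, same_law (x n k l) a)
    (hx_indep : forall n l,
       graph_independent_variables (g' n) (fun k => x n k l)) :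
  exists (B : ncProbSpace R) (s : nonempty_set L -> B),
    limit_joint_law gL w s /\
    cvg_star_distribution
      (fun n => normalized_sum lambda (x n))
      (\sum_(J : nonempty_set L)
         (sigma ^+ #|val J| * lambda ^+ #|~: val J|)%:C *: s J).
Proof.
have [B [s slaw]] := limit_family_exists gL hg'.
exists B, s; split=> // p t p0.
pose y n (v : 'I_n * 'I_L) : A := x n v.1 v.2 - lambda%:C%:A.
have y_sa n v : adj (y n v) = y n v.
  rewrite /y Defs.adjD -scaleNr -rmorphN adjZr adj_one; congr (_ + _).
  exact: hx_sa.
have x_moment n k l m : tau A (x n k l ^+ m) = tau A (a ^+ m) by exact: hx_law.
have e_sym n : symmetric (nested_adjacent gL (g' n)).
  by apply: nested_adjacent_sym; exact: adjacent_sym.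
have e_irr n : irreflexive (nested_adjacent gL (g' n)).
  by apply: nested_adjacent_irr; exact: adjacent_irr.
pose S n (v : 'I_n * 'I_L) : set A := generated_by (x n v.1 v.2).
have S_alg n v : subalgebra (S n v) by exact: generated_subalgebra.
have S_indep n : word_independent (nested_adjacent gL (g' n)) (S n).
  apply: (@nested_independent R A 'I_L 'I_n gL (g' n) (@adjacent_sym _ gL)
    (@adjacent_irr _ gL) (@adjacent_sym _ (g' n)) (@adjacent_irr _ (g' n)) Al) => //.
  - by move=> k l; apply: generated_subset; [exact: hAl | exact: hx_mem].
  - exact: graph_word_independent.
  - by move=> l; apply: graph_word_independent; exact: hx_indep.
have Sy n v : S n v (y n v).
  apply: (@subalgebra_center R A _ (S n) (S_alg n) v); exact: mem_generated.
have y_tau n v : tau A (y n v) = 0.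
  by rewrite linearB /= tau_scalar -[x n v.1 v.2]expr1 x_moment expr1 hmean subrr.
have y_var n v : tau A (y n v * y n v) = sigma%:C ^+ 2.
  have -> : y n v * y n v = x n v.1 v.2 ^+ 2 - lambda%:C *: x n v.1 v.2 -
      (lambda%:C *: x n v.1 v.2 - lambda%:C *: lambda%:C%:A).
    by rewrite /y mulrBl !mulrBr -!scalerAl -!scalerAr !mulr1 !mul1r.
  have tx : tau A (x n v.1 v.2) = lambda%:C.
    by rewrite -[x n v.1 v.2]expr1 x_moment expr1.
  have tB u z : tau A (u - z) = tau A u - tau A z by exact: linearB.
  have tZ c u : tau A (c *: u) = c * tau A u by exact: linearZ.
  rewrite !tB !tZ tau1 x_moment tx mulr1 subrr subr0.
  by rewrite -rmorphXn /= -hvar hmean expr2.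
have y_bound N : exists C : R, forall n (u : seq ('I_n * 'I_L)), (size u <= N)%N ->
    `|tau A (\prod_(v <- u) y n v)| <= C%:C.
  (* The centered letters are centered first powers, hence the degree bound 1; the moments of [a]
     are common to all n. *)
  have [C C1 hC] := tau_powers_bound (fun m => tau A (a ^+ m)) N 1.
  exists (complex.Re C) => n u uN.
  have -> : (complex.Re C)%:C = C.
    move: C1; rewrite lecE /= => /andP[/eqP im0 _].
    by rewrite [RHS]complexE im0 mulr0 addr0.
  have memS v : S n v (x n v.1 v.2) by exact: mem_generated.
  have := hC A _ _ (S n) (fun v => x n v.1 v.2) (e_sym n) (S_alg n) (S_indep n)
    memS (fun v m => x_moment n v.1 v.2 m)
    [seq (v, 1%N) | v <- u].
  rewrite size_map big_map all_map => /(_ uN); rewrite all_predT.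
  move=> /(_ isT); congr (`|tau A _| <= _); apply: eq_bigr => v _.
  by rewrite !expr1 hmean.
have lcvg (J : 'I_p -> nonempty_set L) := @label_sum_cvg R L gL g' w sigma (fun=> A) y
  hg' y_bound (fun n v u cu => tau_letter_singleton (e_sym n) (S_alg n) (S_indep n)
    (Sy n) (y_tau n) cu)
  (fun n u cu => tau_letter_pairs (e_sym n) (S_alg n) (S_indep n)
    (Sy n) (y_tau n) (y_var n) cu) p J t p0.
(* Both the moment and its limit are expanded over families [J]. The powers of [lambda] are
   coefficients on both sides, while those of [sigma] arise in the limit of the label sums. *)
have momentE n : tau A (\prod_(j < p) star_pow (t j) (normalized_sum lambda (x n))) =
    \sum_(J : {ffun 'I_p -> nonempty_set L})
      (\prod_(j < p) lambda ^+ #|~: val (J j)|)%:C *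
      tau A (\prod_(j < p) label_sum (y n) (t j) (val (J j))).
  under eq_bigr => j _ do rewrite normalized_sumE star_pow_sum.
  rewrite tau_prod_sum; apply: eq_bigr => J _; congr (_ * tau A _).
  by apply: eq_bigr => j _; exact: (star_label_sum _ _ (y_sa n)).
have limitE : tau B (\prod_(j < p) star_pow (t j) (\sum_(J : nonempty_set L)
      (sigma ^+ #|val J| * lambda ^+ #|~: val J|)%:C *: s J)) =
    \sum_(J : {ffun 'I_p -> nonempty_set L})
      (\prod_(j < p) lambda ^+ #|~: val (J j)|)%:C *
      (sigma ^+ total_label J * \sum_(pi | admissible_partition J gL t pi)
         partition_integral w J pi)%:C.
  under eq_bigr => j _ do rewrite star_pow_sum.
  rewrite tau_prod_sum; apply: eq_bigr => J _.
  rewrite (slaw p J t p0) big_split /= -!rmorphM /= mulrA; congr ((_ * _)%:C).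
  by rewrite mulrC /total_label expr_sum.
rewrite limitE; under eq_fun do rewrite momentE.
by apply: cvg_bigsum => J _; apply: cvgM; [exact: cvg_cst | exact: lcvg].
Qed.
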